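(* (Tropical moving lemma.) Let $K$ be a complete, nontrivially valued non-Archimedean field. Let $X$ and $X'$ be closed subschemes of $\mathbb T$, and suppose that $\mathrm{codim}(X)+\mathrm{codim}(X')=\dim(\mathbb T)$. Choose polyhedral complex structures on $\mathrm{Trop}(X)$ and $\mathrm{Trop}(X')$. Let $C$ be a connected component of $\mathrm{Trop}(X)\cap\mathrm{Trop}(X')$ and let $(\Delta,\mathcal P)$ be a compactifying datum for $X,X'$ and $C$. Then there exist a $\Delta$-thickening $\mathcal P'$ of $\mathcal P$, a number $\epsilon>0$, and a cocharacter $v\in N$ with the following properties: (1) $(\Delta,\mathcal P')$ is a compactifying datum for $X$, $X'$ and $C$. (2) For all $r\in[-\epsilon,0)\cup(0,\epsilon]$, the set $(\mathrm{Trop}(X)+r\cdot v)\cap\mathrm{Trop}(X')\cap|\mathcal P'|$ is finite and contained in $|\mathcal P'|^\circ$, and each point lies in the interior of facets of $\mathrm{Trop}(X)+r\cdot v$ and $\mathrm{Trop}(X')$.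
   Context: $M\cong\mathbb Z^n$, $N=\mathrm{Hom}(M,\mathbb Z)$, $N_{\mathbb R}=N\otimes\mathbb R$, $\mathbb T=\mathrm{Spec}\,K[M]$, $G=\mathrm{val}(\overline K^\times)\subseteq\mathbb R$. For a closed subscheme $X\subseteq\mathbb T$, $\mathrm{Trop}(X)\subseteq N_{\mathbb R}$ is the image of $X^{\mathrm{an}}$ under $\mathrm{trop}$, where $\langle u,\mathrm{trop}(\|\cdot\|)\rangle=\log\|x^u\|$ for $u\in M$ with character $x^u$; equivalently the closure of $\{\mathrm{trop}(\xi)\}$ over closed points $\xi$ of $X$, $\langle u,\mathrm{trop}(\xi)\rangle=-\mathrm{val}(x^u(\xi))$. It is the support of a finite polyhedral complex with integral $G$-affine cells of dimension at most $\dim X$; a choice of such is a polyhedral complex structure. Facets are maximal cells, and ''interior'' of a facet means relative interior. A polyhedron is a nonempty finite intersection of closed half-spaces; it is integral $G$-affine if it has the form $P=\bigcap_i\{v:\langle u_i,v\rangle\le a_i\}$ with $u_i\in M$, $a_i\in G$. Cones are polyhedral; integral cones are generated by elements of $N$; fans are finite; a fan is pointed if its cones contain no line. $|\mathcal P|=\bigcup_{P\in\mathcal P}P$, $|\mathcal P|^\circ$ is its interior in $N_{\mathbb R}$; $\mathcal P\cap\mathcal Q$ is the collection of (nonempty) pairwise intersections. $\rho(P)=\{w:v+w\in P\ \forall v\in P\}$ is the recession cone. A pointed fan $\Delta$ is compatible with $\mathcal P$ if for all $P\in\mathcal P,\sigma\in\Delta$, either $\sigma\subseteq\rho(P)$ or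 $\mathrm{relint}(\sigma)\cap\rho(P)=\emptyset$; it is a compactifying fan for $\mathcal P$ if each $\rho(P)$, $P\in\mathcal P$, is a union of cones in $\Delta$. A compactifying datum for $X,X'$ and $C$ is a pair $(\Delta,\mathcal P)$, where $\mathcal P$ is a finite collection of integral $G$-affine polyhedra in $N_{\mathbb R}$ with $\mathrm{Trop}(X)\cap\mathrm{Trop}(X')\cap|\mathcal P|=C$ (as sets) and $\Delta$ is an integral compactifying fan for $\mathcal P$ which is compatible with $\mathrm{Trop}(X')\cap\mathcal P$ (intersections of cells of $\mathrm{Trop}(X')$ with members of $\mathcal P$). A thickening of $P=\bigcap_i\{\langle u_i,v\rangle\le a_i\}$ is a polyhedron $\bigcap_i\{\langle u_i,v\rangle\le a_i+\delta\}$ with $\delta>0$ in $G$; a thickening of a collection consists of a thickening of each member. A refinement of a finite collection $\mathcal P$ of integral $G$-affine polyhedra is a finite collection of integral $G$-affine polyhedra, each contained in some member of $\mathcal P$, such that each member of $\mathcal P$ is a union of members of the refinement. A $\Delta$-decomposition of $\mathcal P$ is a refinement all of whose recession cones are in $\Delta$; a $\Delta$-thickening of $\mathcal P$ is a thickening of a $\Delta$-decomposition of $\mathcal P$. *)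

(* Defs.v *)
From HB Require Import structures.
From mathcomp Require Import all_boot all_order all_algebra.
From mathcomp Require Import all_classical all_reals all_analysis.

Set Implicit Arguments.
Unset Strict Implicit.
Unset Printing Implicit Defensive.
Import Order.TTheory GRing.Theory Num.Theory.
Import numFieldNormedType.Exports.
Local Open Scope classical_set_scope.
Local Open Scope ring_scope.

(** * Non-Archimedean fields *)

(* The valuation is val x = - ln `|x|; val 0 = +oo corresponds to `|0| = 0. *)
Record nonarch_abs (R : realType) (K : fieldType) (abs : K -> R) : Prop := {
  nonarch_abs_ge0 : forall x, 0 <= abs x;
  nonarch_abs_eq0 : forall x, abs x = 0 <-> x = 0;
  nonarch_absM : forall x y, abs (x * y) = abs x * abs y;
  nonarch_absD : forall x y, abs (x + y) <= Num.max (abs x) (abs y) }.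

Definition nontrivial_abs (R : realType) (K : fieldType) (abs : K -> R) : Prop :=
  exists x : K, x != 0 /\ abs x != 1.

Definition complete_abs (R : realType) (K : fieldType) (abs : K -> R) : Prop :=
  forall u : nat -> K,
    (forall e : R, 0 < e -> exists N, forall i j,
       (N <= i)%N -> (N <= j)%N -> abs (u i - u j) < e) ->
    exists l : K, (fun i => abs (u i - l)) @ \oo --> (0 : R).

(* An algebraic closure of (K, abs), with an extension of the absolute value. *)
Record algebraic_closure (R : realType) (K : fieldType) (abs : K -> R)
    (Kbar : closedFieldType) (iota : {rmorphism K -> Kbar})
    (absbar : Kbar -> R) : Prop := {
  algebraic_closure_alg : forall x : Kbar, algebraicOver iota x;
  algebraic_closure_abs : nonarch_abs absbar;
  algebraic_closure_ext : forall x : K, absbar (iota x) = abs x }.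

Definition value_group (R : realType) (K : fieldType) (abs : K -> R) : set R :=
  [set - ln (abs x) | x in [set x : K | x != 0]].

(** * Ideals, dimension and codimension *)

Section Dimension.
Context (R : realType) (A : comNzRingType).
Implicit Types I p q : set A.

(* The unit ideal is allowed; it defines the empty closed subscheme. *)
Definition ideal I : Prop :=
  [/\ I 0, forall a b, I a -> I b -> I (a + b) & forall a b, I b -> I (a * b)].

Definition prime_ideal p : Prop :=
  [/\ ideal p, ~ p 1 & forall a b, p (a * b) -> p a \/ p b].

Definition prime_chain (p : nat -> set A) (m : nat) : Prop :=
  (forall i, (i <= m)%N -> prime_ideal (p i)) /\
  (forall i, (i < m)%N -> p i `<` p i.+1).

(* The dimension of the closed subscheme V(I) of Spec A, as an extended real;
   it is -oo if V(I) is empty. *)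
Definition krull_dim I : \bar R :=
  ereal_sup [set (m%:R)%:E | m in
    [set m | exists2 p, prime_chain p m & I `<=` p 0%N]].

Definition height q : \bar R :=
  ereal_sup [set (m%:R)%:E | m in
    [set m | exists2 p, prime_chain p m & p m = q]].

(* The codimension of V(I) in Spec A; it is +oo if V(I) is empty. *)
Definition codim I : \bar R :=
  ereal_inf [set height q | q in [set q | prime_ideal q /\ I `<=` q]].

End Dimension.
Arguments krull_dim R {A} I.
Arguments codim R {A} I.

(** * Tropicalization *)

(* The character lattice M and the cocharacter lattice N are both identified
   with Z^n, and N_R with R^n, in such a way that the pairing of M with N_R is
   the dot product. *)
Definition dot (R : realType) (n : nat) (u v : 'rV[R]_n) : R :=
  \sum_(i < n) u 0 i * v 0 i.

Definition intv (R : realType) (n : nat) (u : 'rV[int]_n) : 'rV[R]_n :=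
  map_mx (intr : int -> R) u.
Arguments intv R {n} u.

(* A is the group algebra K[M], with basis the characters x^u = chi u. *)
Record group_algebra (K : fieldType) (n : nat) (A : comAlgType K)
    (chi : 'rV[int]_n -> A) : Prop := {
  group_algebra_chi0 : chi 0 = 1;
  group_algebra_chiD : forall u v, chi (u + v) = chi u * chi v;
  group_algebra_span : forall a : A, exists s : seq 'rV[int]_n,
    exists c : 'rV[int]_n -> K, a = \sum_(u <- s) c u *: chi u;
  group_algebra_free : forall (s : seq 'rV[int]_n) (c : 'rV[int]_n -> K),
    uniq s -> \sum_(u <- s) c u *: chi u = 0 -> forall u, u \in s -> c u = 0 }.

(* The points of the analytification of V(I): the multiplicative seminorms on
   A / I extending the absolute value of K, seen as seminorms on A. *)
Record analytic_point (R : realType) (K : fieldType) (abs : K -> R)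
    (A : comAlgType K) (I : set A) (nu : A -> R) : Prop := {
  analytic_point_ge0 : forall a, 0 <= nu a;
  analytic_pointM : forall a b, nu (a * b) = nu a * nu b;
  analytic_pointD : forall a b, nu (a + b) <= Num.max (nu a) (nu b);
  analytic_point_ext : forall c : K, nu (c *: 1) = abs c;
  analytic_point_ideal : forall a, I a -> nu a = 0 }.

Definition Trop (R : realType) (K : fieldType) (abs : K -> R) (n : nat)
    (A : comAlgType K) (chi : 'rV[int]_n -> A) (I : set A) : set 'rV[R]_n :=
  [set w | exists2 nu, analytic_point abs I nu &
           forall u, dot (intv R u) w = ln (nu (chi u))].

(** * Polyhedral geometry *)

Section Polyhedra.
Context (R : realType) (n : nat).
Local Notation V := 'rV[R]_n.
Local Notation M := 'rV[int]_n.
Implicit Types (P F S sigma : set V) (G : set R) (calP calQ Delta : set (set V)).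

Definition affine_hull P : set V :=
  [set v | exists m (p : 'I_m -> V) (l : 'I_m -> R),
    [/\ forall i, P (p i), \sum_i l i = 1 & v = \sum_i l i *: p i]].

Definition relint P : set V :=
  [set v | P v /\ \forall w \near within (affine_hull P) (nbhs v), P w].

(* The dimension of the affine hull of P: the largest d such that P contains
   d + 1 affinely independent points p, p + row 0 B, ..., p + row (d - 1) B. *)
Definition polydim P : nat :=
  \max_(d < n.+1 | `[< exists p (B : 'M[R]_(d, n)),
                       [/\ P p, row_free B & forall i, P (p + row i B)] >]) d.

Definition halfspaces (s : seq (V * R)) : set V :=
  [set v | forall h, h \in s -> dot h.1 v <= h.2].

Definition polyhedron P : Prop :=
  P !=set0 /\ exists s, P = halfspaces s.

(* The polyhedron with integral presentation <u, v> <= a for (u, a) in s. *)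
Definition int_halfspaces (s : seq (M * R)) : set V :=
  halfspaces [seq (intv R h.1, h.2) | h <- s].

Definition affine_presentation G (s : seq (M * R)) P : Prop :=
  (forall h, h \in s -> G h.2) /\ P = int_halfspaces s.

Definition integral_affine G P : Prop :=
  P !=set0 /\ exists s, affine_presentation G s P.

Definition face F P : Prop :=
  F !=set0 /\ exists c : V,
    F = [set v | P v /\ forall w, P w -> dot c w <= dot c v].

Definition polyhedral_complex calP : Prop :=
  [/\ finite_set calP,
      forall P, calP P -> polyhedron P,
      forall P F, calP P -> face F P -> calP F &
      forall P Q, calP P -> calP Q -> P `&` Q !=set0 ->
        face (P `&` Q) P /\ face (P `&` Q) Q].

Definition supp calP : set V := \bigcup_(P in calP) P.

Definition facet calP P : Prop :=
  calP P /\ forall Q, calP Q -> P `<=` Q -> Q = P.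

Definition translate (w : V) S : set V := [set v + w | v in S].

Definition translates (w : V) calP : set (set V) :=
  [set translate w P | P in calP].

Definition inter_collection calP calQ : set (set V) :=
  [set S | S !=set0 /\ exists P Q, [/\ calP P, calQ Q & S = P `&` Q]].

Definition recession P : set V := [set w | forall v, P v -> P (v + w)].

Definition cone sigma : Prop :=
  exists s : seq V, sigma = [set v | forall u, u \in s -> dot u v <= 0].

Definition integral_cone sigma : Prop :=
  cone sigma /\ exists s : seq M, sigma =
    [set v | exists l : M -> R,
       (forall u, 0 <= l u) /\ v = \sum_(u <- s) l u *: intv R u].

Definition contains_line S : Prop :=
  exists p d : V, d != 0 /\ forall t : R, S (p + t *: d).

Definition fan Delta : Prop :=
  polyhedral_complex Delta /\ forall sigma, Delta sigma -> cone sigma.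

Definition pointed_fan Delta : Prop :=
  fan Delta /\ forall sigma, Delta sigma -> ~ contains_line sigma.

Definition integral_fan Delta : Prop :=
  fan Delta /\ forall sigma, Delta sigma -> integral_cone sigma.

Definition compatible Delta calP : Prop :=
  pointed_fan Delta /\
  forall P sigma, calP P -> Delta sigma ->
    sigma `<=` recession P \/ relint sigma `&` recession P = set0.

Definition compactifying_fan Delta calP : Prop :=
  pointed_fan Delta /\
  forall P, calP P -> exists2 D, D `<=` Delta & recession P = supp D.

Definition affine_collection G calP : Prop :=
  finite_set calP /\ forall P, calP P -> integral_affine G P.

Definition refinement G calP calQ : Prop :=
  [/\ affine_collection G calQ,
      forall Q, calQ Q -> exists2 P, calP P & Q `<=` P &
      forall P, calP P -> exists2 D, D `<=` calQ & P = supp D].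

(* The thickening depends on the chosen integral G-affine presentation of P;
   any presentation is allowed. *)
Definition thickening G P P' : Prop :=
  exists s (delta : R),
    [/\ affine_presentation G s P, G delta, 0 < delta &
        P' = int_halfspaces [seq (h.1, h.2 + delta) | h <- s]].

Definition collection_thickening G calP calP' : Prop :=
  exists2 f : set V -> set V,
    forall P, calP P -> thickening G P (f P) & calP' = f @` calP.

Definition fan_decomposition G Delta calP calQ : Prop :=
  refinement G calP calQ /\ forall Q, calQ Q -> Delta (recession Q).

Definition fan_thickening G Delta calP calP' : Prop :=
  exists2 calQ, fan_decomposition G Delta calP calQ &
                collection_thickening G calQ calP'.

End Polyhedra.

(* Sigma is a polyhedral complex structure on Trop(X), where X = V(I). *)
Definition complex_structure (R : realType) (K : fieldType) (abs : K -> R)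
    (G : set R) (n : nat) (A : comAlgType K) (chi : 'rV[int]_n -> A)
    (I : set A) (Sigma : set (set 'rV[R]_n)) : Prop :=
  [/\ polyhedral_complex Sigma,
      forall P, Sigma P -> integral_affine G P,
      forall P, Sigma P -> (((polydim P)%:R)%:E <= krull_dim R I)%E &
      Trop abs chi I = supp Sigma].

(* A compactifying datum for X, X' and C, where T = Trop(X), T' = Trop(X') and
   Sigma' is the polyhedral complex structure on T'. *)
Definition compactifying_datum (R : realType) (n : nat) (G : set R)
    (T T' : set 'rV[R]_n) (Sigma' : set (set 'rV[R]_n)) (C : set 'rV[R]_n)
    (Delta calP : set (set 'rV[R]_n)) : Prop :=
  [/\ affine_collection G calP,
      T `&` T' `&` supp calP = C,
      integral_fan Delta,
      compactifying_fan Delta calP &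
      compatible Delta (inter_collection Sigma' calP)].

(* Main.v *)
Require Import Defs.
From HB Require Import structures.
From mathcomp Require Import all_boot all_order all_algebra.
From mathcomp Require Import all_classical all_reals all_analysis.
From mathcomp Require Import ring lra zify.

(** Let [C] be cut out of [Trop(X) `&` Trop(X')] by [|P|]. Writing a member [P] as
    [(P `&` box) + rho(P)] and splitting [rho(P)] into cones of [Delta] gives a
    [Delta]-decomposition, integral by Fourier-Motzkin elimination. By Farkas'
    lemma an infeasible system of inequalities stays infeasible under a small
    relaxation; so a small thickening meets no new cells of the intersection,
    each of which, being connected, lies in [C] or misses it.

    Cells [F], [F'] of the two tropicalizations satisfy [dim F + dim F' <= n],
    because [K[M]] has Krull dimension at most [n]. If their directions do not
    span, [F - F'] lies in a hyperplane, which [r v] misses for small nonzero [r]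
    and general [v]. So only complementary cells contribute; they meet
    in one point, and a proper face or a larger cell would have the wrong
    dimension, whence relative interiors and facets. Finally a point of
    [(F + r v) `&` F'] in the thickening is close, by Hoffman's bound, to
    a point of [C], hence of [|P|], so it is interior to the thickening. *)

Set Implicit Arguments.
Unset Strict Implicit.
Unset Printing Implicit Defensive.
Import Order.TTheory GRing.Theory Num.Theory.
Import numFieldNormedType.Exports.
Local Open Scope classical_set_scope.
Local Open Scope ring_scope.

(** * Bilinearity of the dot product *)

Section Dot.
Context (R : realType) (n : nat).
Implicit Types (u v w : 'rV[R]_n) (c : R).

Lemma dotDl u v w : dot (u + v) w = dot u w + dot v w.
Proof. by rewrite -big_split; apply: eq_bigr => i _; rewrite !mxE mulrDl. Qed.

Lemma dotDr u v w : dot u (v + w) = dot u v + dot u w.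
Proof. by rewrite -big_split; apply: eq_bigr => i _; rewrite !mxE mulrDr. Qed.

Lemma dotZl c u v : dot (c *: u) v = c * dot u v.
Proof. by rewrite mulr_sumr; apply: eq_bigr => i _; rewrite mxE mulrA. Qed.

Lemma dotC u v : dot u v = dot v u.
Proof. by apply: eq_bigr => i _; rewrite mulrC. Qed.

Lemma dotZr c u v : dot u (c *: v) = c * dot u v.
Proof. by rewrite dotC dotZl dotC. Qed.

Lemma dotNl u v : dot (- u) v = - dot u v.
Proof. by rewrite -scaleN1r dotZl mulN1r. Qed.

Lemma dotNr u v : dot u (- v) = - dot u v.
Proof. by rewrite -scaleN1r dotZr mulN1r. Qed.

Lemma dotBr u v w : dot u (v - w) = dot u v - dot u w.
Proof. by rewrite dotDr dotNr. Qed.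

Lemma dot0l v : dot 0 v = 0.
Proof. by rewrite -(scale0r 0) dotZl mul0r. Qed.

Lemma dot0r v : dot v 0 = 0.
Proof. by rewrite dotC dot0l. Qed.

Lemma dot_suml (J : Type) (r : seq J) (P : pred J) (F : J -> 'rV[R]_n) v :
  dot (\sum_(j <- r | P j) F j) v = \sum_(j <- r | P j) dot (F j) v.
Proof.
by apply: (big_morph (fun u => dot u v)) => [u w|]; rewrite ?dotDl ?dot0l.
Qed.

Lemma dot_sumr (J : Type) (r : seq J) (P : pred J) (F : J -> 'rV[R]_n) v :
  dot v (\sum_(j <- r | P j) F j) = \sum_(j <- r | P j) dot v (F j).
Proof. by rewrite dotC dot_suml; apply: eq_bigr => j _; rewrite dotC. Qed.

Lemma dot_delta u (i : 'I_n) : dot u (delta_mx 0 i) = u 0 i.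
Proof.
rewrite /dot (bigD1 i) //= big1 ?mxE ?eqxx ?mulr1 ?addr0 // => j ji.
by rewrite mxE (negPf ji) andbF mulr0.
Qed.

End Dot.

(** * Linear inequalities: elimination, Farkas' lemma and Hoffman's bound *)

Section Farkas.
Context (R : realType).

(** The one-variable case of Farkas' lemma. Either list may be empty, so neither the largest lower
    bound nor the smallest upper bound is always available as [t]. *)
Lemma between_seqs (l u : seq R) :
  (forall x y, x \in l -> y \in u -> x <= y) ->
  exists t, (forall x, x \in l -> x <= t) /\ (forall y, y \in u -> t <= y).
Proof.
elim: l => [_|x l IH lu].
  elim: u => [|y u [t [_ tu]]]; first by exists 0.
  exists (Num.min y t); split=> // z; rewrite inE => /predU1P[->|/tu tz].
    by rewrite ge_min lexx.
  by rewrite ge_min tz orbT.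
have [|t [lt tu]] := IH; first by move=> z y zl; apply: lu; rewrite inE zl orbT.
exists (Num.max x t); split=> z.
  rewrite inE => /predU1P[->|/lt zt]; first by rewrite le_max lexx.
  by rewrite le_max zt orbT.
by move=> zu; rewrite ge_max tu // andbT lu // inE eqxx.
Qed.

(* Fourier-Motzkin elimination of one variable: an inequality with a vanishing
   coefficient is kept, and every lower bound is compared with every upper
   bound; pairs (j, j') of any other kind get the zero multiplier. *)
Definition fm_mult (J : finType) (al : J -> R) (p : J * J) (j : J) : R :=
  if (0 < al p.1) && (al p.2 < 0)
  then - al p.2 *+ (j == p.1) + al p.1 *+ (j == p.2)
  else if (p.1 == p.2) && (al p.1 == 0) then (j == p.1)%:R else 0.

Lemma fm_mult_ge0 (J : finType) (al : J -> R) p j : 0 <= fm_mult al p j.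
Proof.
rewrite /fm_mult; case: ifP => [/andP[a0 b0]|_].
  by rewrite addr_ge0 ?mulrn_wge0 ?oppr_ge0 // ltW.
by case: ifP => // _; rewrite ler0n.
Qed.

Lemma fm_mult_int (J : finType) (al : J -> R) p j :
  (forall i, al i \is a Num.int) -> fm_mult al p j \is a Num.int.
Proof.
move=> ali; rewrite /fm_mult; case: ifP => _.
  by rewrite rpredD // rpredMn // rpredN.
by case: ifP => _; rewrite ?rpred0 // rpred_nat.
Qed.

(** Stated over an arbitrary module in order to serve both the normal vectors and, through [R^o],
    the right-hand sides. *)
Lemma fm_mult_sum (J : finType) (al : J -> R) p (V : lmodType R) (f : J -> V) :
  \sum_j fm_mult al p j *: f j =
  if (0 < al p.1) && (al p.2 < 0)
  then - al p.2 *: f p.1 + al p.1 *: f p.2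
  else if (p.1 == p.2) && (al p.1 == 0) then f p.1 else 0.
Proof.
have E c q : \sum_j (c *+ (j == q)) *: f j = c *: f q :> V.
  rewrite (bigD1 q) //= big1 ?eqxx ?addr0 // => j jq.
  by rewrite (negPf jq) scale0r.
rewrite /fm_mult; case: ifP => _.
  under eq_bigr do rewrite scalerDl.
  by rewrite big_split /= !E.
case: ifP => _; first by rewrite E scale1r.
by rewrite big1 // => j _; rewrite scale0r.
Qed.

(** A pair with coefficients of opposite signs puts a lower bound for [t] below an upper bound; a
    diagonal pair with zero coefficient gives the inequality in which [t] does not occur. *)
Lemma fm_sound (J : finType) (al be : J -> R) :
  (forall p, 0 <= \sum_j fm_mult al p j * be j) ->
  exists t, forall j, al j * t <= be j.
Proof.
move=> H.
have {}H p := H p; have {}H p : 0 <= \sum_j fm_mult al p j *: (be j : R^o) := H p.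
have [|t [lt tu]] := @between_seqs
    [seq be j / al j | j <- enum J & al j < 0]
    [seq be j / al j | j <- enum J & 0 < al j].
  move=> _ _ /mapP[j + ->] /mapP[i + ->]; rewrite !mem_filter.
  move=> /andP[j0 _] /andP[i0 _].
  have := H (i, j); rewrite fm_mult_sum /= i0 j0 /= /GRing.scale /= => h.
  rewrite ler_pdivlMr // mulrAC ler_ndivrMr //.
  by rewrite -subr_ge0; move: h; rewrite mulNr addrC mulrC [al j * _]mulrC.
exists t => j; case: (ltgtP (al j) 0) => a0.
- rewrite mulrC -ler_ndivrMr //; apply: lt; apply/mapP; exists j => //.
  by rewrite mem_filter a0 mem_enum.
- rewrite mulrC -ler_pdivlMr //; apply: tu; apply/mapP; exists j => //.
  by rewrite mem_filter a0 mem_enum.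
- by have := H (j, j); rewrite fm_mult_sum /= a0 ltxx !eqxx /= mul0r.
Qed.

(* The multipliers do not depend on the right-hand sides: this is what makes
   projections of polyhedra polyhedral. *)
Lemma farkas n (J : finType) (a : J -> 'rV[R]_n) :
  exists (K : finType) (l : K -> J -> R),
    [/\ forall k j, 0 <= l k j, forall k, \sum_j l k j *: a j = 0,
        (forall j i, a j 0 i \is a Num.int) -> forall k j, l k j \is a Num.int &
        forall b, (forall k, 0 <= \sum_j l k j * b j) ->
                  exists x, forall j, dot (a j) x <= b j].
Proof.
(* Induction on the number [m] of leading coordinates in which the [a j] may be nonzero. Each step
   eliminates the last of them and replaces the index type [J] by [J * J]. *)
suff : forall m (J : finType) (a : J -> 'rV[R]_n),
    (forall j (i : 'I_n), (m <= i)%N -> a j 0 i = 0) ->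
  exists (K : finType) (l : K -> J -> R),
    [/\ forall k j, 0 <= l k j, forall k, \sum_j l k j *: a j = 0,
        (forall j i, a j 0 i \is a Num.int) -> forall k j, l k j \is a Num.int &
        forall b, (forall k, 0 <= \sum_j l k j * b j) ->
                  exists x, forall j, dot (a j) x <= b j].
  by move=> /(_ n); apply=> j i; rewrite leqNgt ltn_ord.
elim=> {J a} [|m IH] J a a0.
  have {}a0 j : a j = 0 by apply/rowP => i; rewrite a0 // mxE.
  exists J, (fun k j => (j == k)%:R); split=> [k j|k|_ k j|b bl].
  - exact: ler0n.
  - by rewrite big1 // => j _; rewrite a0 scaler0.
  - exact: rpred_nat.
  - exists 0 => j; rewrite dot0r; have := bl j.
    rewrite (bigD1 j) //= big1 ?eqxx ?mul1r ?addr0 // => i /negPf ->.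
    by rewrite mul0r.
have [mn|nm] := ltnP m n; last first.
  by apply: IH => j i /(leq_trans nm); rewrite leqNgt ltn_ord.
pose im := Ordinal mn; pose al j := a j 0 im.
pose a' p := \sum_j fm_mult al p j *: a j.
have a'0 p (i : 'I_n) : (m <= i)%N -> a' p 0 i = 0.
  rewrite leq_eqVlt => /predU1P[mi|mi]; last first.
    by rewrite summxE big1 // => j _; rewrite mxE a0 // mulr0.
  have -> : i = im by apply: val_inj.
  rewrite /a' fm_mult_sum; case: ifP => _; first by rewrite !mxE /al; ring.
  by case: ifP => [/andP[_ /eqP]|]; rewrite ?mxE.
have [K [l [l0 la li lb]]] := IH _ a' a'0.
exists K, (fun k j => \sum_p l k p * fm_mult al p j); split=> [k j|k|ai k j|b bl].
- by apply: sumr_ge0 => p _; rewrite mulr_ge0 ?fm_mult_ge0.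
- rewrite -[RHS](la k); under eq_bigr do rewrite scaler_suml.
  rewrite exchange_big /=; apply: eq_bigr => p _.
  by rewrite /a' scaler_sumr; apply: eq_bigr => j _; rewrite scalerA.
- apply: rpred_sum => p _; apply: rpredM; last by apply: fm_mult_int => i; apply: ai.
  apply: li => q i; rewrite summxE; apply: rpred_sum => j' _.
  by rewrite mxE rpredM // fm_mult_int // => i'; apply: ai.
- have [k|x xb] := lb (fun p => \sum_j fm_mult al p j * b j).
    have := bl k; rewrite le_eqVlt; under eq_bigr do rewrite mulr_suml.
    rewrite exchange_big -le_eqVlt /=; congr (_ <= _); apply: eq_bigr => p _.
    by rewrite mulr_sumr; apply: eq_bigr => j _; rewrite mulrA.
  have [p|t tb] := @fm_sound J al (fun j => b j - dot (a j) x).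
    under eq_bigr do rewrite mulrBr; rewrite sumrB subr_ge0.
    have := xb p; rewrite /a' dot_suml; congr (_ <= _).
    by apply: eq_bigr => j _; rewrite dotZl.
  exists (x + t *: delta_mx 0 im) => j; rewrite dotDr dotZr dot_delta.
  by have := tb j; rewrite lerBrDr addrC mulrC.
Qed.

(** The wish that [x] be within [H * d] of [y] is itself a system of [2n] inequalities. Farkas'
    lemma for the enlarged system leaves finitely many conditions on [H], and these involve the
    multipliers only, hence neither [b] nor [y]. *)
Lemma hoffman n (J : finType) (a : J -> 'rV[R]_n) :
  exists2 H : R, 0 <= H & forall (b : J -> R) y d, 0 <= d ->
    (exists x, forall j, dot (a j) x <= b j) ->
    (forall j, dot (a j) y <= b j + d) ->
    exists x, (forall j, dot (a j) x <= b j) /\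
              (forall i, `|x 0 i - y 0 i| <= H * d).
Proof.
pose a' (j : J + ('I_n + 'I_n)) := match j with
  | inl j => a j | inr (inl i) => delta_mx 0 i | inr (inr i) => - delta_mx 0 i end.
have [K [l [l0 la _ lb]]] := farkas a'.
pose mu k := \sum_i (l k (inr (inl i)) + l k (inr (inr i))).
pose L k := \sum_j l k (inl j).
have mu0 k : 0 <= mu k by apply: sumr_ge0 => i _; rewrite addr_ge0.
have L0 k : 0 <= L k by apply: sumr_ge0.
(* A sum instead of a maximum. Here [mu k] is the weight that multiplier [k] gives to the box
   inequalities; where it is zero the quotient is zero by convention. *)
exists (\sum_k L k / mu k).
  by apply: sumr_ge0 => k _; rewrite divr_ge0.
move=> b y d d0 [x0 x0b] yb; set H := \sum_k _.
pose b' (j : J + ('I_n + 'I_n)) := match j with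
  | inl j => b j | inr (inl i) => y 0 i + H * d | inr (inr i) => - y 0 i + H * d end.
have sumE k (f : J + ('I_n + 'I_n) -> R) : \sum_j l k j * f j =
  \sum_j l k (inl j) * f (inl j) + \sum_i (l k (inr (inl i)) * f (inr (inl i))
     + l k (inr (inr i)) * f (inr (inr i))).
  rewrite !big_sumType /= big_split //.
have dotE k z : \sum_j l k j * dot (a' j) z = 0.
  transitivity (dot (\sum_j l k j *: a' j) z); last by rewrite la dot0l.
  by rewrite dot_suml; apply: eq_bigr => j _; rewrite dotZl.
have [k|x xb] := lb b'; last first.
  exists x; split=> [j|i]; first exact: (xb (inl j)).
  have := xb (inr (inl i)); have := xb (inr (inr i)) => /=.
  rewrite dotNl dotC dot_delta ler_norml => h1 h2; apply/andP; split; lra.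
have := dotE k y; rewrite !sumE /= => E.
have -> : \sum_j l k (inl j) * b j + \sum_i (l k (inr (inl i)) * (y 0 i + H * d)
    + l k (inr (inr i)) * (- y 0 i + H * d)) =
  \sum_j l k (inl j) * (b j - dot (a j) y) + mu k * (H * d).
  rewrite -[LHS]subr0 -[X in _ - X]E opprD addrACA -!sumrB; congr (_ + _).
    by apply: eq_bigr => j _; rewrite mulrBr.
  rewrite [mu k * _]mulr_suml; apply: eq_bigr => i _.
  rewrite dotNl [dot (delta_mx _ _) _]dotC dot_delta; ring.
(* A multiplier without weight on the box concerns the original system alone, which is feasible by
   [x0]; any other is handled by the size of [H]. *)
have [muk|muk] := eqVneq (mu k) 0.
  rewrite muk mul0r addr0.
  have z i : l k (inr (inl i)) = 0 /\ l k (inr (inr i)) = 0.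
    have /eqP := muk; rewrite psumr_eq0 => [|j _]; last by rewrite addr_ge0.
    move=> /allP/(_ i (mem_index_enum _)); rewrite paddr_eq0 //.
    by move=> /andP[/eqP -> /eqP ->].
  have F w : \sum_j l k (inl j) * dot (a j) w = 0.
    rewrite -[RHS](dotE k w) sumE /= [X in _ = _ + X]big1 ?addr0 // => i _.
    by have [-> ->] := z i; rewrite !mul0r addr0.
  rewrite (_ : \sum_j _ = \sum_j l k (inl j) * (b j - dot (a j) x0)).
    by apply: sumr_ge0 => j _; rewrite mulr_ge0 // subr_ge0.
  under eq_bigr do rewrite mulrBr; under [RHS]eq_bigr do rewrite mulrBr.
  by rewrite !sumrB !F.
have muk0 : 0 < mu k by rewrite lt_neqAle eq_sym muk mu0.
have : L k * d <= mu k * (H * d).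
  rewrite mulrA ler_wpM2r // mulrC -ler_pdivrMr //.
  by rewrite /H (bigD1 k) //= lerDl sumr_ge0 // => i _; rewrite divr_ge0.
move=> h; rewrite addrC -[X in _ + X]opprK subr_ge0 (le_trans _ h) //.
rewrite -sumrN mulr_suml ler_sum // => j _.
rewrite -mulrN ler_wpM2l // opprB lerBlDl //.
Qed.

(** Infeasibility is certified by a multiplier with negative value [s] on the right-hand sides.
    Relaxing by [e] raises this value by [L * e]; for [e = - s / (L + 1)] it becomes [s / (L + 1)],
    still negative. *)
Lemma infeasible_relax n (J : finType) (a : J -> 'rV[R]_n) (b : J -> R) :
  ~ (exists x, forall j, dot (a j) x <= b j) ->
  exists2 e : R, 0 < e & ~ (exists x, forall j, dot (a j) x <= b j + e).
Proof.
move=> nx; have [K [l [l0 la _ lb]]] := farkas a.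
have [k kb] : exists k, \sum_j l k j * b j < 0.
  apply: contrapT => /forallNP h; apply/nx/lb => k.
  by rewrite leNgt; apply/negP/h.
set s := \sum_j _ in kb; pose L := \sum_j l k j.
have L0 : 0 <= L by apply: sumr_ge0.
exists (- s / (L + 1)); first by rewrite divr_gt0 ?oppr_gt0 ?ltr_wpDl.
move=> [x xb].
have : 0 <= \sum_j l k j * (b j + - s / (L + 1)).
  rewrite -[leLHS](dot0l x) -(la k) dot_suml ler_sum // => j _.
  by rewrite dotZl ler_wpM2l.
under eq_bigr do rewrite mulrDr.
rewrite big_split /= -mulr_suml -/s -/L mulrA.
have -> : s + L * (- s) / (L + 1) = s / (L + 1) by field; rewrite gt_eqF ?ltr_wpDl.
by rewrite leNgt pmulr_llt0 ?kb // invr_gt0 ltr_wpDl.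
Qed.

End Farkas.

(** * Neighbourhoods in the sup norm, and convexity *)

Section RowTopology.
Context (R : realType) (n : nat).
Implicit Types (x y u v w : 'rV[R]_n) (S : set 'rV[R]_n).

Lemma nbhs_rowP x S : nbhs x S <->
  exists2 e : R, 0 < e & forall y, (forall i, `|x 0 i - y 0 i| < e) -> S y.
Proof.
split=> [/nbhs_ballP[e /= e0 xS]|[e e0 xS]].
  exists e => // y xy; apply: xS; split=> // i j; rewrite ord1; exact: xy.
apply/nbhs_ballP; exists e => //= y [_ xy]; apply: xS => i; exact: xy.
Qed.

Lemma dot_le u w (M : R) : (forall i, `|w 0 i| <= M) ->
  `|dot u w| <= (\sum_i `|u 0 i|) * M.
Proof.
move=> wM; rewrite mulr_suml (le_trans (ler_norm_sum _ _ _)) // ler_sum // => i _.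
by rewrite normrM ler_wpM2l.
Qed.

Lemma nbhs_dot_lt u x b : dot u x < b -> \forall y \near x, dot u y < b.
Proof.
move=> xb; apply/nbhs_rowP; pose L := \sum_i `|u 0 i|.
have L0 : 0 <= L by apply: sumr_ge0.
have L1 : 0 < L + 1 by rewrite ltr_wpDl.
exists ((b - dot u x) / (L + 1)) => [|y xy]; first by rewrite divr_gt0 ?subr_gt0.
have : `|dot u (y - x)| <= L * ((b - dot u x) / (L + 1)).
  by apply: dot_le => i; rewrite !mxE distrC ltW.
rewrite dotBr => /(le_trans (ler_norm _)) h.
rewrite -subr_gt0; suff : L * ((b - dot u x) / (L + 1)) < b - dot u x by lra.
by rewrite mulrA ltr_pdivrMr // [ltRHS]mulrDr mulr1 mulrC ltrDl subr_gt0.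
Qed.

Lemma cvg_line x w S : nbhs x S ->
  exists2 t : R, 0 < t & forall s, `|s| <= t -> S (x + s *: w).
Proof.
move=> /nbhs_rowP[e e0 xS]; pose M := \sum_i `|w 0 i|.
have M1 : 0 < M + 1 by rewrite ltr_wpDl // sumr_ge0.
exists (e / (M + 1)) => [|s st]; first by rewrite divr_gt0.
apply: xS => i; rewrite !mxE opprD addrA subrr add0r normrN normrM.
have wM : `|w 0 i| <= M by rewrite /M (bigD1 i) //= lerDl sumr_ge0.
apply: le_lt_trans (_ : e / (M + 1) * M < _).
  by rewrite ler_pM.
by rewrite mulrAC ltr_pdivrMr // mulrDr mulr1 ltrDl.
Qed.

Definition convex S := forall x y (t : R),
  S x -> S y -> 0 <= t <= 1 -> S (x + t *: (y - x)).

(** The segment from [x] to [y] is a connected subset of [T], being a continuous image of the unit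
    interval. *)
Lemma convex_connected_component S (T : set 'rV[R]_n) x y :
  convex S -> S `<=` T -> S x -> S y -> connected_component T x y.
Proof.
move=> cS ST Sx Sy; pose g (t : R) := x + t *: (y - x).
have gc : continuous g.
  by move=> t; apply: cvgD; [exact: cvg_cst | apply: cvgZr_tmp; exact: cvg_id].
exists (g @` `[0%R, 1%R]); last first.
  by exists 1; rewrite /= ?in_itv /= ?ler01 ?lexx // /g scale1r addrC subrK.
split.
- by exists 0; rewrite /= ?in_itv /= ?ler01 ?lexx // /g scale0r addr0.
- by move=> _ [t + <-]; rewrite /= in_itv /= => t01; apply/ST/cS.
- apply: connected_continuous_connected; first exact: segment_connected.
  exact: continuous_subspaceT.
Qed.

End RowTopology.

(** * Polyhedra, their thickenings and recession cones *)

Section HalfSpaces.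
Context (R : realType) (n : nat).
Local Notation V := 'rV[R]_n.
Implicit Types (x y u v w : V) (s t : seq (V * R)) (P Q F S : set V).

Lemma halfspaces_nth s x : halfspaces s x <->
  forall j : 'I_(size s), dot (nth (0, 0) s j).1 x <= (nth (0, 0) s j).2.
Proof.
split=> [sx j|sx h /(nthP (0, 0))[j js <-]]; first exact: sx (mem_nth _ (ltn_ord j)).
exact: (sx (Ordinal js)).
Qed.

Lemma halfspaces_cat s t : halfspaces (s ++ t) = halfspaces s `&` halfspaces t.
Proof.
apply/seteqP; split=> x /= => [st|[sx tx] h]; last first.
  by rewrite mem_cat => /orP[hs|ht]; [apply: sx | apply: tx].
by split=> h hs; apply: st; rewrite mem_cat hs ?orbT.
Qed.

(** Acts on presentations, because the relaxed polyhedron depends on the inequalities chosen and not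
    only on the set that they cut out. *)
Definition thick (d : R) s : seq (V * R) := [seq (h.1, h.2 + d) | h <- s].

Lemma thick_cat d s t : thick d (s ++ t) = thick d s ++ thick d t.
Proof. exact: map_cat. Qed.

Lemma thick0 s : thick 0 s = s.
Proof. by rewrite /thick -[RHS]map_id; apply: eq_map => -[a b]; rewrite addr0. Qed.

Lemma halfspaces_thickP d s x : halfspaces (thick d s) x <->
  forall h, h \in s -> dot h.1 x <= h.2 + d.
Proof.
split=> [sx h hs|sx _ /mapP[h hs ->]]; last exact: (sx h hs).
by apply: (sx (h.1, h.2 + d)); apply/mapP; exists h.
Qed.

Lemma thick_sub d e s : d <= e -> halfspaces (thick d s) `<=` halfspaces (thick e s).
Proof.
move=> de x /halfspaces_thickP sx; apply/halfspaces_thickP => h hs.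
by apply: le_trans (sx h hs) _; rewrite lerD2l.
Qed.

Lemma thick_sub0 d s : 0 <= d -> halfspaces s `<=` halfspaces (thick d s).
Proof. by move=> d0; rewrite -[X in halfspaces X `<=` _]thick0; apply: thick_sub. Qed.

Lemma thick_set0 s : halfspaces s = set0 ->
  exists2 e : R, 0 < e & forall d, d <= e -> halfspaces (thick d s) = set0.
Proof.
move=> s0; have [|e e0 ne] := @infeasible_relax R n 'I_(size s)
    (fun j => (nth (0, 0) s j).1) (fun j => (nth (0, 0) s j).2).
  by move=> [x /halfspaces_nth]; rewrite s0.
exists e => // d de; rewrite -subset0 => x /(thick_sub de) xs; apply: ne.
by exists x => j; move/halfspaces_thickP: xs; apply; apply: mem_nth.
Qed.

Lemma hoffman_thick s : halfspaces s !=set0 ->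
  exists2 H : R, 0 <= H & forall d y, 0 <= d -> halfspaces (thick d s) y ->
    exists2 x, halfspaces s x & forall i, `|x 0 i - y 0 i| <= H * d.
Proof.
move=> [x0 /halfspaces_nth x0s].
have [H H0 HP] := hoffman (fun j : 'I_(size s) => (nth (0, 0) s j).1).
exists H => // d y d0 /halfspaces_thickP ys.
have [|j|x [xs xy]] := HP (fun j => (nth (0, 0) s j).2) y d d0.
- by exists x0.
- by apply: ys; apply: mem_nth.
- by exists x => //; apply/halfspaces_nth.
Qed.

Lemma halfspaces_convex s : convex (halfspaces s).
Proof.
move=> x y t sx sy /andP[t0 t1] h hs; have := sx h hs; have := sy h hs.
rewrite dotDr dotZr dotBr => h1 h2; nra.
Qed.

(** By the Archimedean property a positive slope would exceed any bound. Natural multiples of [w]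
    are what iterating a recession vector provides. *)
Lemma dot_ray_le0 u x w (b : R) :
  (forall k : nat, dot u x + k%:R * dot u w <= b) -> dot u w <= 0.
Proof.
move=> h; rewrite leNgt; apply/negP => w0.
pose k := Num.bound ((b - dot u x) / dot u w).
have b0 : 0 <= b - dot u x by have := h 0%N; rewrite mul0r addr0 subr_ge0.
have : (b - dot u x) / dot u w < k%:R by apply: archi_boundP; rewrite divr_ge0 // ltW.
rewrite ltr_pdivrMr // ltNge => /negP; apply.
by have := h k; lra.
Qed.

(** A presentation of the recession cone, provided that [halfspaces s] is nonempty. *)
Definition homogeneous s : seq (V * R) := [seq (h.1, 0) | h <- s].

Lemma halfspaces_homogeneousP s w : halfspaces (homogeneous s) w <->
  forall h, h \in s -> dot h.1 w <= 0.
Proof.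
split=> [sw h hs|sw _ /mapP[h hs ->]]; last exact: (sw h hs).
by apply: (sw (h.1, 0)); apply/mapP; exists h.
Qed.

Lemma recession_iter P w x (k : nat) : recession P w -> P x -> P (x + k%:R *: w).
Proof.
move=> Pw Px; elim: k => [|k IH]; first by rewrite scale0r addr0.
by rewrite -natr1 scalerDl scale1r addrA; apply: Pw.
Qed.

Lemma recession_sub_homogeneous P s w : P !=set0 -> P `<=` halfspaces s ->
  recession P w -> halfspaces (homogeneous s) w.
Proof.
move=> [x Px] Ps Pw; apply/halfspaces_homogeneousP => h hs.
apply: (@dot_ray_le0 _ x _ h.2) => k.
by rewrite -dotZr -dotDr; apply/Ps => //; apply: recession_iter.
Qed.

Lemma recession_halfspaces s : halfspaces s !=set0 ->
  recession (halfspaces s) = halfspaces (homogeneous s).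
Proof.
move=> s0; apply/seteqP; split=> w.
  exact: recession_sub_homogeneous.
move=> /halfspaces_homogeneousP sw x sx h hs.
by rewrite dotDr -[leRHS]addr0 lerD ?sx ?sw.
Qed.

(** A ray of [P] from one point stays in [Q], and in a polyhedron a single ray already forces its
    direction to be a recession vector. *)
Lemma recessionS P Q : polyhedron Q -> P !=set0 -> P `<=` Q ->
  recession P `<=` recession Q.
Proof.
move=> [Q0 [s QE]] P0; rewrite QE in Q0 *.
move=> PQ w Pw; rewrite recession_halfspaces //.
exact: recession_sub_homogeneous P0 PQ Pw.
Qed.

Lemma recessionI P Q : polyhedron P -> polyhedron Q -> P `&` Q !=set0 ->
  recession (P `&` Q) = recession P `&` recession Q.
Proof.
move=> pP pQ PQ0; apply/seteqP; split=> [w PQw|w [Pw Qw] x [Px Qx]].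
  by split; move: w PQw; apply: recessionS => // x [].
by split; [apply: Pw | apply: Qw].
Qed.

Lemma homogeneous_thick d s : homogeneous (thick d s) = homogeneous s.
Proof. by rewrite /homogeneous -map_comp. Qed.

Lemma face_sub F P : face F P -> F `<=` P.
Proof. by move=> [_ [c ->]] x []. Qed.

Lemma cone0 S : cone S -> S 0.
Proof. by move=> [s ->] u _; rewrite dot0r. Qed.

Lemma coneD S x y : cone S -> S x -> S y -> S (x + y).
Proof.
by move=> [s ->] sx sy u us; rewrite dotDr -[leRHS]addr0 lerD ?sx ?sy.
Qed.

(** * Dimension, faces and relative interiors *)

Lemma row_free_col_mx d (B : 'M[R]_(d, n)) v :
  row_free B -> ~~ (v <= B)%MS -> row_free (col_mx B v).
Proof.
move=> fB vB; rewrite /row_free eqn_leq rank_leq_row /=.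
apply: (@leq_trans (\rank B).+1); first by rewrite (eqP fB) addn1.
apply: rank_ltmx; rewrite /ltmx col_mx_sub submx_refl /= vB andbT.
by have := submx_refl (col_mx B v); rewrite col_mx_sub => /andP[].
Qed.

Lemma polydim_ge P d p (B : 'M[R]_(d, n)) : P p -> row_free B ->
  (forall i, P (p + row i B)) -> (d <= polydim P)%N.
Proof.
move=> Pp fB PB; have dn : (d < n.+1)%N by rewrite ltnS -(eqP fB) rank_leq_col.
have := @leq_bigmax_cond _ (fun d : 'I_n.+1 => `[< exists p (B : 'M[R]_(d, n)),
    [/\ P p, row_free B & forall i, P (p + row i B)] >])
  (fun d : 'I_n.+1 => d : nat) (Ordinal dn).
by apply; apply/asboolP; exists p, B.
Qed.

Lemma polydim_frame P : P !=set0 -> exists p (B : 'M[R]_(polydim P, n)),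
  [/\ P p, row_free B & forall i, P (p + row i B)].
Proof.
move=> [p Pp]; pose D (d : 'I_n.+1) := `[< exists p (B : 'M[R]_(d, n)),
    [/\ P p, row_free B & forall i, P (p + row i B)] >].
have D0 : D ord0.
  by apply/asboolP; exists p, 0; split=> // [|[]//]; rewrite /row_free mxrank0.
have [|d /asboolP Dd E] := @eq_bigmax_cond _ D (fun d : 'I_n.+1 => d : nat).
  by apply/card_gt0P; exists ord0.
by rewrite /polydim -/D E.
Qed.

Lemma frame_extend P d p (B : 'M[R]_(d, n)) q : P p -> row_free B ->
  (forall i, P (p + row i B)) -> P q -> ~~ (q - p <= B)%MS ->
  (d < polydim P)%N.
Proof.
move=> Pp fB PB Pq /(row_free_col_mx fB) f; rewrite -addn1.
apply: polydim_ge Pp f _ => i; have [j ->|j ->] := split_ordP i.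
  by rewrite rowKu.
rewrite rowKd; have -> : row j (q - p) = q - p.
  by apply/rowP => k; rewrite !mxE ord1.
by rewrite addrC subrK.
Qed.

Lemma frame_span P p (B : 'M[R]_(polydim P, n)) q : P p -> row_free B ->
  (forall i, P (p + row i B)) -> P q -> (q - p <= B)%MS.
Proof.
move=> Pp fB PB Pq; apply: contraT => /(frame_extend Pp fB PB Pq).
by rewrite ltnn.
Qed.

Lemma dot_submx_eq0 d (B : 'M[R]_(d, n)) c v :
  (forall i, dot c (row i B) = 0) -> (v <= B)%MS -> dot c v = 0.
Proof.
move=> cB /submxP[D ->]; rewrite mulmx_sum_row dot_sumr big1 // => i _.
by rewrite dotZr cB mulr0.
Qed.

(** The functional [c] defining the face is constant on [F], so it vanishes on a maximal frame of
    [F]. It does not vanish on [w - p], which therefore extends the frame inside [P]. *)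
Lemma polydim_face_lt P F w : face F P -> P w -> ~ F w ->
  (polydim F < polydim P)%N.
Proof.
move=> fF Pw Fw; have [F0 [c FE]] := fF.
have [p [B [Fp fB FB]]] := polydim_frame F0.
have FP := face_sub fF.
apply: (frame_extend (FP _ Fp) fB (fun i => FP _ (FB i)) Pw).
have cmax x : F x -> forall y, P y -> dot c y <= dot c x by rewrite FE => -[].
have cB i : dot c (row i B) = 0.
  have := cmax _ (FB i) _ (FP _ Fp); have := cmax _ Fp _ (FP _ (FB i)).
  rewrite dotDr; lra.
apply/negP => /(dot_submx_eq0 cB); rewrite dotBr => /eqP; rewrite subr_eq0 => /eqP E.
by apply: Fw; rewrite FE; split=> // y Py; rewrite E; apply: cmax.
Qed.

(** An inequality tight at [x] but strict somewhere cuts out a proper face through [x]. If there is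
    none, each inequality is either strict at [x], hence valid nearby, or an equation on the
    polyhedron, hence on its affine hull. *)
Lemma relint_or_face s x : halfspaces s x -> relint (halfspaces s) x \/
  exists F, [/\ face F (halfspaces s), F x &
                (polydim F < polydim (halfspaces s))%N].
Proof.
move=> sx; have [[h hs [hx [w sw hw]]]|nh] := pselect (exists2 h, h \in s &
    dot h.1 x = h.2 /\ exists2 w, halfspaces s w & dot h.1 w < h.2).
  right; pose F := [set v | halfspaces s v /\
                          forall y, halfspaces s y -> dot h.1 y <= dot h.1 v].
  have Fx : F x by split=> // y sy; rewrite hx; apply: sy.
  have fF : face F (halfspaces s) by split; [exists x | exists h.1].
  exists F; split=> //; apply: polydim_face_lt fF sw _ => -[_ /(_ x sx)].
  by rewrite hx leNgt hw.
left; split=> //; rewrite /within /=.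
have eq_or_lt h : h \in s -> (dot h.1 x < h.2) \/
    (forall y, affine_hull (halfspaces s) y -> dot h.1 y <= h.2).
  move=> hs; have := sx h hs; rewrite le_eqVlt => /predU1P[hx|]; last by left.
  right=> _ [m [p [l [sp l1 ->]]]]; rewrite dot_sumr.
  rewrite -[leRHS]mul1r -l1 mulr_suml ler_sum // => i _.
  rewrite dotZr; suff -> : dot h.1 (p i) = h.2 by [].
  apply/eqP; rewrite eq_le sp //= leNgt; apply/negP => lt.
  by apply: nh; exists h => //; split=> //; exists (p i).
suff : \forall y \near x, affine_hull (halfspaces s) y ->
    forall h, h \in s -> dot h.1 y <= h.2 by [].
(* The set whose affine hull is taken is generalized to [H], so that it stays fixed while the list
   gets shorter. *)
elim: s {sx nh} (halfspaces s) eq_or_lt => [|h s IH] H eq_or_lt.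
  by near=> y => _ h; rewrite in_nil.
have hy : \forall y \near x, affine_hull H y -> dot h.1 y <= h.2.
  have [/nbhs_dot_lt|he] := eq_or_lt h (mem_head _ _).
    by apply: filterS => y /ltW.
  by near=> y; apply: he.
have sy : \forall y \near x, affine_hull H y -> forall h, h \in s -> dot h.1 y <= h.2.
  by apply: IH => h' hs; apply: eq_or_lt; rewrite inE hs orbT.
near=> y => Hy h'; rewrite inE => /predU1P[->|hs].
  by move: Hy; near: y.
by move: h' hs; move: Hy; near: y.
Unshelve. all: by end_near. Qed.

(** The segment from [w] to [x] can be prolonged inside [S] a little beyond [x]. A linear functional
    maximal at [x] is then constant on it, so it is maximal at [w] too. *)
Lemma relint_face_sub S F x : face F S -> relint S x -> F x -> S `<=` F.
Proof.
move=> [_ [c FE]] [Sx nSx] Fx w Sw; rewrite FE in Fx *; split=> // y Sy.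
case: Fx => _ cmax; apply: le_trans (cmax y Sy) _.
have [t t0 tS] := cvg_line (x - w) nSx.
have : S (x + t *: (x - w)).
  apply: tS; first by rewrite gtr0_norm.
  exists 2, (fun i => if i == 0 then x else w), (fun i => if i == 0 then 1 + t else - t).
  split=> [i||]; first by case: ifP.
    by rewrite !big_ord_recl big_ord0 /= addr0 addrK.
  rewrite !big_ord_recl big_ord0 /= addr0 scalerDl scale1r scalerBr scaleNr.
  by rewrite addrA.
move=> /cmax; rewrite dotDr dotZr dotBr => h; nra.
Qed.

Lemma relint_translate P w x : relint P x -> relint (translate w P) (x + w).
Proof.
move=> [Px /nbhs_rowP[e e0 nP]]; split; first by exists x.
apply/nbhs_rowP; exists e => // y xy [m [p [l [Pp l1 yE]]]].
exists (y - w); last by rewrite subrK.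
apply: nP => [i|]; first by have := xy i; rewrite !mxE opprB addrA.
exists m, (fun i => p i - w), l; split=> // [i|].
  by have [v Pv <-] := Pp i; rewrite addrK.
rewrite yE; under [RHS]eq_bigr do rewrite scalerBr.
by rewrite sumrB -scaler_suml l1 scale1r.
Qed.

Lemma translateS w P Q : translate w P `<=` translate w Q -> P `<=` Q.
Proof.
move=> PQ x Px; have [|y Qy /addIr <-//] := PQ (x + w); by exists x.
Qed.

Lemma facet_translates w (calP : set (set V)) F :
  facet calP F -> facet (translates w calP) (translate w F).
Proof.
move=> [PF maxF]; split; first by exists F.
by move=> _ [Q PQ <-] /translateS/(maxF _ PQ) ->.
Qed.

End HalfSpaces.

(** * Chains of prime ideals and monomials *)

Section PrimeChains.
Context (A : comNzRingType).
Implicit Types (p : nat -> set A) (q : set A).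

Lemma prime_idealX q x k : prime_ideal q -> q (x ^+ k) -> q x.
Proof.
move=> [_ q1 qM]; elim: k => [|k IH]; first by rewrite expr0.
by rewrite exprS => /qM[].
Qed.

Lemma prime_chain_le p m k :
  prime_chain p m -> (k <= m)%N -> prime_chain p k.
Proof.
move=> [pp ps] km; split=> i ik; first exact/pp/(leq_trans ik).
exact/ps/(leq_trans ik).
Qed.

(** The common prime is counted once, so lengths add; this is the source of the bound of height plus
    dimension by the length of a longest chain. *)
Lemma prime_chain_cat p p' k m : prime_chain p k -> prime_chain p' m ->
  p k = p' 0%N ->
  prime_chain (fun i => if (i <= k)%N then p i else p' (i - k)%N) (k + m).
Proof.
move=> [pp ps] [pp' ps'] E; split=> i ik.
  by case: ifP => [/pp//|/negbT]; rewrite -ltnNge => ki; apply: pp'; lia.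
have [ki|ki] := ltnP i k.
  by rewrite (ltnW ki); apply: ps.
have [->|ik'] := eqVneq i k.
  rewrite leqnn E -[X in p' X](subnn k) subSn // subnn; apply: ps'; lia.
have -> : (i <= k)%N = false by lia.
rewrite subSn //; apply: ps'; lia.
Qed.

End PrimeChains.

(** Nested pairs rather than functions, so that induction on [m] can split off the exponent of the
    first variable. *)
Fixpoint exponents (D m : nat) : finType :=
  if m is m'.+1 then ('I_D * exponents D m')%type else unit.

Fixpoint monomial (A : comNzRingType) (D m : nat) (x : nat -> A) :
    exponents D m -> A :=
  match m with
  | 0 => fun=> 1
  | m'.+1 => fun e => x 0%N ^+ e.1 * monomial (x \o succn) e.2
  end.

Lemma card_exponents D m : #|exponents D m| = (D ^ m)%N.
Proof.
elim: m => [|m IH]; first by rewrite card_unit.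
by rewrite /= card_prod IH card_ord expnS.
Qed.

(* The Coquand-Lombardi argument: among the x_0-exponents of a relation modulo
   p 0 the least one yields a relation in the other variables modulo p 1. *)
Lemma monomial_free_mod (K : fieldType) (A : comAlgType K) D m
    (p : nat -> set A) (x : nat -> A) (c : exponents D m -> K) :
  prime_chain p m -> (forall i, (i < m)%N -> p i.+1 (x i) /\ ~ p i (x i)) ->
  p 0%N (\sum_e c e *: monomial x e) -> forall e, c e = 0.
Proof.
elim: m p x c => [|m IH] p x c [pp ps] px.
  have [[_ _ pM] p1 _] := pp 0%N (leqnn _).
  rewrite (bigD1 tt) //= big1 ?addr0 => [|[]//] pc [].
  apply/eqP/negP => /negP c0; apply: p1.
  rewrite (_ : 1 = (c tt)^-1%:A * (c tt *: 1)); first exact: pM.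
  by rewrite -scalerAl mul1r scalerA mulVf // scale1r.
pose y (j : 'I_D) := \sum_e c (j, e) *: monomial (x \o succn) e.
have -> : \sum_e c e *: monomial x e = \sum_(j < D) x 0%N ^+ j * y j.
  transitivity (\sum_(j < D) \sum_e
      c (j, e) *: (x 0%N ^+ j * monomial (x \o succn) e)).
    by rewrite pair_bigA; apply: eq_bigr => -[].
  apply: eq_bigr => j _; rewrite mulr_sumr; apply: eq_bigr => e _.
  by rewrite scalerAr.
move=> py.
(* Once the coefficients with [x 0]-exponent below [k] vanish, [x 0 ^+ k] factors out and is
   cancelled modulo the prime [p 0]. Modulo [p 1], which contains [x 0], only [y j] with [j = k]
   survives. *)
suff H : forall k (j : 'I_D), (j < k)%N -> forall e, c (j, e) = 0.
  by move=> [j e]; apply: (H j.+1).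
elim=> // k IHk j; rewrite ltnS leq_eqVlt => /predU1P[jk|]; last exact: IHk.
have [_ _ p0P] := pp 0%N (leq0n _).
have [[_ p1D p10M] _ _] := pp 1%N (leq_trans (ltn0Sn 0) (ltn0Sn m)).
have [p1x p0x] := px 0%N (ltn0Sn m).
pose z := \sum_(i < D | (k < i)%N) x 0%N ^+ (i - k.+1) * y i.
have E : \sum_(j < D) x 0%N ^+ j * y j = x 0%N ^+ k * (y j + x 0%N * z).
  rewrite mulrDr -jk (bigD1 j) //=; congr (_ + _).
  rewrite mulrA -exprSr jk mulr_sumr [LHS](bigID (fun i : 'I_D => (k < i)%N)) /=.
  rewrite [X in _ + X]big1 ?addr0.
    apply: eq_big => [i|i /andP[_ ki]]; last by rewrite mulrA -exprD subnKC.
    by rewrite -(inj_eq val_inj) /= jk; lia.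
  move=> i /andP[ij ki]; rewrite /y big1 ?mulr0 // => e _.
  rewrite IHk ?scale0r //; move: ij ki; rewrite -(inj_eq val_inj) /= jk; lia.
move: py; rewrite E => /p0P[/prime_idealX|py]; first by move/(_ (pp 0%N (leq0n _)))/p0x.
have {}py : p 1%N (y j + x 0%N * z) by have [sub _] := ps 0%N (ltn0Sn m); apply: sub.
have {}py : p 1%N (y j).
  rewrite -(addrK (x 0%N * z) (y j)) -mulN1r; apply: p1D => //.
  by apply: (p10M); rewrite mulrC; apply: (p10M).
apply: (IH (p \o succn) (x \o succn) (fun e => c (j, e))) => //.
  by split=> i im; [apply: pp | apply: ps].
by move=> i im; apply: px.
Qed.

(** * The Krull dimension of the group algebra, by counting monomials *)

Section LaurentPolynomials.
Context (K : fieldType) (n : nat) (A : comAlgType K) (chi : 'rV[int]_n -> A).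
Hypothesis hA : group_algebra chi.

(** The family [u] may repeat exponents, which lets a product be indexed by pairs without collecting
    terms. *)
Definition supported_in_box (B : nat) (a : A) : Prop :=
  exists (J : finType) (c : J -> K) (u : J -> 'rV[int]_n),
    (forall j i, `|u j 0 i| <= B%:Z) /\ a = \sum_j c j *: chi (u j).

Lemma supported_le B B' a :
  (B <= B')%N -> supported_in_box B a -> supported_in_box B' a.
Proof.
move=> BB [J [c [u [ub ->]]]]; exists J, c, u; split=> // j i.
by apply: le_trans (ub j i) _; rewrite lez_nat.
Qed.

Lemma supported1 B : supported_in_box B 1.
Proof.
exists unit, (fun=> 1), (fun=> 0); split=> [j i|]; first by rewrite mxE normr0.
by rewrite (bigD1 tt) //= big1 ?addr0 ?scale1r ?(group_algebra_chi0 hA) // => -[].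
Qed.

Lemma supportedM B B' a a' : supported_in_box B a -> supported_in_box B' a' ->
  supported_in_box (B + B') (a * a').
Proof.
move=> [J [c [u [ub ->]]]] [J' [c' [u' [ub' ->]]]].
exists (J * J')%type, (fun q => c q.1 * c' q.2), (fun q => u q.1 + u' q.2).
split=> [j i|].
  by rewrite mxE PoszD (le_trans (ler_normD _ _)) // lerD.
rewrite mulr_suml -(pair_bigA _ (fun i j => (c i * c' j) *: chi (u i + u' j))) /=.
apply: eq_bigr => j _; rewrite mulr_sumr; apply: eq_bigr => j' _.
by rewrite -scalerAl -scalerAr scalerA (group_algebra_chiD hA).
Qed.

Lemma supportedX B a k : supported_in_box B a -> supported_in_box (k * B) (a ^+ k).
Proof.
move=> Ba; elim: k => [|k IH]; first exact: supported1.
by rewrite exprS mulSn; apply: supportedM.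
Qed.

Lemma supported_monomial B D m (x : nat -> A) (e : exponents D m) :
  (forall i, (i < m)%N -> supported_in_box B (x i)) ->
  supported_in_box (m * (D * B)) (monomial x e).
Proof.
elim: m x e => [|m IH] x e xB; first exact: supported1.
rewrite mulSn; apply: supportedM; last by apply: IH => i im; apply: xB.
apply: supported_le (supportedX _ (xB 0%N _)) => //.
by rewrite leq_mul2r ltnW ?orbT.
Qed.

Lemma supported_ex a : exists B, supported_in_box B a.
Proof.
have [s [c ->]] := group_algebra_span hA a.
exists (\max_(u <- s) \max_i `|u 0%R i|%N)%N, 'I_(size s),
  (fun j : 'I_(size s) => c (nth 0 s j)),
  (fun j : 'I_(size s) => nth 0 s j); split=> [j i|].
  rewrite -abszE lez_nat.
  have js : nth 0 s j \in s by apply: mem_nth.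
  apply: (@leq_trans (\max_i `|nth 0%R s j 0%R i|)%N); first exact: (leq_bigmax i).
  exact: (@leq_bigmax_seq _ s xpredT (fun u : 'rV_n => \max_i `|u 0%R i|)%N).
by rewrite (big_nth 0) big_mkord.
Qed.

Lemma supported_coord B a : supported_in_box B a ->
  exists c : {ffun 'I_n -> 'I_(B.*2.+1)} -> K,
    a = \sum_f c f *: chi (\row_i ((f i : nat)%:Z - B%:Z)).
Proof.
move=> [J [c [u [ub ->]]]].
(* Shifting by [B] turns exponents between [-B] and [B] into natural numbers at most [2B]. *)
pose g j : {ffun 'I_n -> 'I_(B.*2.+1)} := [ffun i => inord `|(u j 0 i + B%:Z)%R|%N].
have gE j : \row_i ((g j i : nat)%:Z - B%:Z) = u j.
  apply/rowP => i; rewrite !mxE ffunE.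
  have := ub j i; rewrite ler_norml => /andP[lb ub'].
  have ge0 : 0 <= u j 0 i + B%:Z by rewrite -lerBlDr sub0r.
  rewrite inordK; first by rewrite gez0_abs // addrK.
  by rewrite -ltz_nat gez0_abs //; move: ub'; lia.
exists (fun f => \sum_(j | g j == f) c j).
rewrite (partition_big g predT) //=; apply: eq_bigr => f _.
rewrite scaler_suml; apply: eq_bigr => j /eqP <-; by rewrite gE.
Qed.

(** All [m e] lie in the span of the characters in the box, of which there are [B.*2.+1 ^ n]. A
    larger family satisfies a nontrivial relation, whose value [0] lies in [q]. *)
Lemma card_le_supported B (E : finType) (m : E -> A) (q : set A) : q 0 ->
  (forall e, supported_in_box B (m e)) ->
  (forall c, q (\sum_e c e *: m e) -> forall e, c e = 0) ->
  (#|E| <= B.*2.+1 ^ n)%N.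
Proof.
move=> q0 mB free.
have /choice[C CE] := fun e => supported_coord (mB e); rewrite leqNgt; apply/negP => lt.
pose F := {ffun 'I_n -> 'I_(B.*2.+1)}.
pose Cm : 'M[K]_(#|E|, #|F|) := \matrix_(i, j) C (enum_val i) (enum_val j).
have : kermx Cm != 0.
  rewrite kermx_eq0 /row_free; apply/eqP => r.
  have := rank_leq_col Cm; rewrite r; apply/negP; rewrite -ltnNge.
  by apply: leq_trans lt; rewrite card_ffun !card_ord.
move=> /rowV0Pn[v /sub_kermxP vC /eqP v0]; apply: v0.
apply/rowP => i; rewrite mxE -(enum_valK i).
apply: (free (fun e => v 0 (enum_rank e))).
rewrite (_ : \sum_e _ = 0) //.
under eq_bigr do rewrite CE scaler_sumr.
rewrite exchange_big /= big1 // => f _.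
under eq_bigr do rewrite scalerA; rewrite -scaler_suml.
suff -> : \sum_e v 0 (enum_rank e) * C e f = 0 by rewrite scale0r.
have := congr1 (fun M => fun_of_matrix M 0 (enum_rank f)) vC; rewrite !mxE => vCf.
rewrite -[RHS]vCf.
rewrite [RHS](reindex (@enum_rank E)) /=; last exact: onW_bij (enum_rank_bij _).
by apply: eq_bigr => e _; rewrite mxE !enum_rankK.
Qed.

(** A chain of length [n + 1] yields [n + 1] elements whose monomials are independent modulo [p 0].
    With exponents below [D] these number [D ^ n.+1], whereas their supports lie in a box with only
    about [D ^ n] characters, up to a constant factor. *)
Lemma prime_chain_leq p m : prime_chain (p : nat -> set A) m -> (m <= n)%N.
Proof.
move=> pm; rewrite leqNgt; apply/negP => /(prime_chain_le pm) {m}pm.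
have /choice[x xP] : forall i, exists x, (i < n.+1)%N -> p i.+1 x /\ ~ p i x.
  move=> i; have [/(proj2 pm)[_ h]|_] := ltnP i n.+1; last by exists 0.
  by apply: contrapT => /forallNP nx; apply: h => a pa; apply: contrapT => na; apply: (nx a).
have /choice[b bP] : forall i, exists B, supported_in_box B (x i).
  by move=> i; apply: supported_ex.
pose B := (\max_(i < n.+1) b i)%N.
have xB i : (i < n.+1)%N -> supported_in_box B (x i).
  by move=> im; apply: supported_le (bP i); apply: (leq_bigmax (Ordinal im)).
(* The box has at most [(D * W) ^ n] points, and [D > W ^ n] makes this less than [D ^ n.+1]. *)
pose W := (n.+1 * B).*2.+1; pose D := (W ^ n).+1.
have [[p0 _ _] _ _] := proj1 pm 0%N (leq0n _).
have := @card_le_supported (n.+1 * (D * B)) (exponents D n.+1) _ (p 0%N) p0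
  (fun e => supported_monomial e xB) (fun c => monomial_free_mod pm xP).
rewrite card_exponents; apply/negP; rewrite -ltnNge.
have : ((n.+1 * (D * B)).*2.+1 <= D * W)%N.
  by rewrite /W mulnS mulnCA -doubleMr -addn1 addnC leq_add2r.
have mono i j : (i <= j -> i ^ n <= j ^ n)%N by case: n => // k ij; rewrite leq_exp2r.
move=> /mono.
move=> /leq_ltn_trans; apply.
by rewrite expnMn expnSr ltn_pmul2l ?expn_gt0.
Qed.

(** Let [N] be the length of a longest prime chain. Prolonging a chain of length [d] above [I]
    downwards shows that the codimension is at most [N - d]. Adding the two bounds gives
    [N <= 2N - d - d'], and [N <= n]. *)
Lemma complementary_dim (R : realType) (I I' : set A) :
  (codim R I + codim R I')%E = krull_dim R [set 0 : A] ->
  forall d d' : nat, ((d%:R)%:E <= krull_dim R I)%E ->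
    ((d'%:R)%:E <= krull_dim R I')%E -> (d + d' <= n)%N.
Proof.
(* Lengths are integers and chains can be truncated: without a chain of length [d] the supremum
   would be at most [d - 1]. *)
have long J (d : nat) : ((d%:R)%:E <= krull_dim R J)%E ->
    exists2 p : nat -> set A, prime_chain p d & J `<=` p 0%N.
  move=> dJ; apply: contrapT => /forall2NP np.
  suff : (krull_dim R J < (d%:R)%:E)%E by rewrite ltNge dJ.
  apply: (@le_lt_trans _ _ ((d%:R - 1)%:E)); last by rewrite lte_fin gtrBl.
  apply: ge_ereal_sup => _ [m [p pm Jp] <-]; rewrite lee_fin.
  suff : (m < d)%N by rewrite -(ler_nat R) -natr1 => h; lra.
  by rewrite ltnNge; apply/negP => /(prime_chain_le pm) h; case: (np p).
move=> cod d d' /long[p pd Ip] /long[p' pd' Ip'].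
pose L m := `[< exists p : nat -> set A, prime_chain p m >].
have exL : exists m, L m by exists d; apply/asboolP; exists p.
have bL m : L m -> (m <= n)%N by move=> /asboolP[q]; apply: prime_chain_leq.
have [N /asboolP[q qN] maxN] := ex_maxnP exL bL.
have bound J k (r : nat -> set A) : prime_chain r k -> J `<=` r 0%N ->
    (k <= N)%N /\ (codim R J <= (N%:R - k%:R)%:E)%E.
  move=> rk Jr; split; first by apply: maxN; apply/asboolP; exists r.
  apply: le_trans (_ : height R (r 0%N) <= _)%E.
    by apply: ereal_inf_lbound; exists (r 0%N) => //; split=> //; apply: (proj1 rk).
  apply: ge_ereal_sup => _ [m [p1 p1m E] <-]; rewrite lee_fin lerBrDr -natrD ler_nat.
  apply: maxN; apply/asboolP; eexists; exact: prime_chain_cat p1m rk E.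
have [dN cI] := bound I d p pd Ip; have [dN' cI'] := bound I' d' p' pd' Ip'.
have NK : ((N%:R : R)%:E <= krull_dim R [set (0%R : A)])%E.
  apply: ereal_sup_ubound; exists N => //; exists q => // _ ->.
  by have [[]] := proj1 qN 0%N (leq0n _).
rewrite -cod in NK; have := le_trans NK (leeD cI cI').
rewrite -EFinD lee_fin => h; apply: leq_trans (bL N _); last by apply/asboolP; exists q.
rewrite -(ler_nat R) natrD; lra.
Qed.

End LaurentPolynomials.

(** * Additive subgroups of the reals *)

Section RealSubgroup.
Context (R : realType) (G : set R).
Hypotheses (G0 : G 0) (GB : forall a b, G a -> G b -> G (a - b)).

Lemma subgroupN a : G a -> G (- a).
Proof. by move=> Ga; rewrite -sub0r; apply: GB. Qed.

Lemma subgroupD a b : G a -> G b -> G (a + b).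
Proof. by move=> Ga Gb; rewrite -[b]opprK; apply/GB/subgroupN. Qed.

Lemma subgroup_sum (J : Type) (r : seq J) (F : J -> R) :
  (forall j, G (F j)) -> G (\sum_(j <- r) F j).
Proof.
by move=> GF; apply: (big_ind G) => // a b; apply: subgroupD.
Qed.

Lemma subgroupMz a (z : int) : G a -> G (z%:~R * a).
Proof.
move=> Ga; have GM (k : nat) : G (k%:R * a).
  elim: k => [|k IH]; first by rewrite mul0r.
  by rewrite -natr1 mulrDl mul1r; apply: subgroupD.
case: z => k; first exact: GM.
by rewrite NegzE mulrNz mulNr; apply: subgroupN; apply: GM.
Qed.

Lemma subgroup_unbounded a x : G a -> 0 < a -> exists2 b, G b & x <= b.
Proof.
move=> Ga a0; exists ((Num.bound (`|x| / a))%:R * a); first exact: (subgroupMz (Posz _)).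
rewrite (le_trans (ler_norm x)) // -ler_pdivrMr // ltW // archi_boundP //.
by rewrite divr_ge0 // ltW.
Qed.

End RealSubgroup.

(** * Integral decompositions along a fan *)

Section Decomposition.
Context (R : realType) (n : nat).
Local Notation V := 'rV[R]_n.
Local Notation M := 'rV[int]_n.
Implicit Types (P Q sigma : set V) (s : seq (M * R)) (G : set R).

Definition minkowski P Q : set V := [set v | exists x w, [/\ P x, Q w & v = x + w]].

Lemma int_halfspacesP s x : int_halfspaces s x <->
  forall h, h \in s -> dot (intv R h.1) x <= h.2.
Proof.
split=> [sx h hs|sx _ /mapP[h hs ->]]; last exact: (sx h hs).
by apply: (sx (intv R h.1, h.2)); apply/mapP; exists h.
Qed.

Lemma coneZ sigma (c : R) x : cone sigma -> 0 <= c -> sigma x -> sigma (c *: x).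
Proof.
by move=> [t ->] c0 tx u ut; rewrite dotZr mulr_ge0_le0 ?tx.
Qed.

(** Coefficients indexed by positions, rather than by the generators themselves, become the free
    unknowns of a linear system. *)
Lemma integral_cone_sum sigma : integral_cone sigma ->
  exists m (g : 'I_m -> M),
    sigma = [set w | exists2 l : 'I_m -> R, (forall j, 0 <= l j) &
                     w = \sum_j l j *: intv R (g j)].
Proof.
move=> [cs [g gE]]; exists (size g), (fun j => nth 0 g j).
apply/seteqP; split=> w /=.
  rewrite {1}gE => -[l [l0 ->]]; exists (fun j => l (nth 0 g j)) => //.
  by rewrite (big_nth 0) big_mkord.
move=> [l l0 ->]; apply: (big_ind sigma) => [|x y|j _].
- exact: cone0.
- exact: coneD.
- apply: coneZ => //; rewrite gE; set a := nth 0 g j.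
  have ag : (0 < count_mem a g)%N by rewrite -has_count has_pred1 mem_nth.
  (* A generator listed several times receives the same coefficient each time, so its weight is
     divided by its multiplicity. *)
  exists (fun u => if u == a then (count_mem a g)%:R^-1 else 0); split.
    by move=> u; case: ifP; rewrite ?invr_ge0.
  rewrite (bigID (pred1 a)) /= [X in _ = _ + X]big1 ?addr0; last first.
    by move=> u /negPf ->; rewrite scale0r.
  rewrite (eq_bigr (fun=> (count_mem a g)%:R^-1 *: intv R a)); last first.
    by move=> u /eqP ->; rewrite eqxx.
  rewrite big_const_seq iter_addr_0 -scaler_nat scalerA divff ?scale1r //.
  by rewrite pnatr_eq0 -lt0n.
Qed.

Lemma intv_sum (J : finType) (z : J -> int) (u : J -> M) :
  intv R (\sum_j z j *: u j) = \sum_j (z j)%:~R *: intv R (u j).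
Proof.
apply/rowP => i; rewrite mxE !summxE raddf_sum; apply: eq_bigr => j _.
by rewrite !mxE; exact: intrM.
Qed.

(** The coefficients of the cone vector are eliminated. The system in them has integer entries, so
    the multipliers are integers: the new normals stay in the lattice and the new right-hand sides
    in [G]. *)
Lemma minkowski_cone_integral G s sigma :
  G 0 -> (forall a b, G a -> G b -> G (a - b)) ->
  (forall h, h \in s -> G h.2) -> integral_cone sigma ->
  exists s', (forall h, h \in s' -> G h.2) /\
    minkowski (int_halfspaces s) sigma = int_halfspaces s'.
Proof.
move=> G0 GB Gs /integral_cone_sum[m [g ->]].
pose J := ('I_m + 'I_(size s))%type.
pose h (i : 'I_(size s)) := nth (0, 0) s i.
(* Unknowns are the coefficients [c j]. The rows express [c j >= 0] and that [v] minus the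
   combination of the generators satisfies [s]; [v] enters the right-hand sides only. *)
pose a (j : J) : 'rV[R]_m := match j with
  | inl j => - delta_mx 0 j
  | inr i => - \row_j dot (intv R (h i).1) (intv R (g j)) end.
have [K [l [l0 la li lb]]] := farkas a.
have {}li k j : (Num.floor (l k j))%:~R = l k j.
  apply/floorK/li => -[j'|i'] i; rewrite !mxE ?rpredN ?rpred_nat //.
  by rewrite rpred_sum // => e _; rewrite !mxE rpredM ?intr_int.
pose z k (i : 'I_(size s)) := Num.floor (l k (inr i)).
exists [seq (\sum_i z k i *: (h i).1, \sum_i (z k i)%:~R * (h i).2) | k <- enum K].
split=> [_ /mapP[k _ ->]|] /=.
  by apply: subgroup_sum => // i; apply: subgroupMz => //; apply/Gs/mem_nth.
have aw (c : 'I_m -> R) (j : J) : dot (a j) (\row_j' c j') = match j with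
    | inl j => - c j
    | inr i => - dot (intv R (h i).1) (\sum_j' c j' *: intv R (g j')) end.
  case: j => j /=; rewrite dotNl.
    by rewrite dotC dot_delta mxE.
  rewrite dot_sumr; congr (- _); apply: eq_bigr => j' _.
  by rewrite !mxE dotZr mulrC.
apply/seteqP; split=> v.
  move=> [x [_ [sx [c c0 ->] ->]]]; apply/int_halfspacesP => _ /mapP[k _ ->] /=.
  rewrite intv_sum dot_suml; set w := \sum_j c j *: intv R (g j).
  have E : \sum_(i < size s) l k (inr i) * dot (intv R (h i).1) w =
      - \sum_(j < m) l k (inl j) * c j.
    have := dot0l (\row_j c j); rewrite -(la k) dot_suml.
    under eq_bigr do rewrite dotZl aw.
    rewrite big_sumType /=.
    under eq_bigr do rewrite mulrN.
    under [X in _ + X]eq_bigr do rewrite mulrN.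
    rewrite !sumrN -/w => /eqP; rewrite subr_eq0 => /eqP <-.
    by [].
  apply: le_trans (_ : \sum_(i < size s) l k (inr i) * dot (intv R (h i).1) x <= _).
    rewrite -subr_le0 -sumrB.
    rewrite (eq_bigr (fun i : 'I_(size s) => l k (inr i) * dot (intv R (h i).1) w)).
      by rewrite E oppr_le0 sumr_ge0 // => j _; rewrite mulr_ge0.
    by move=> i _; rewrite dotZl li dotDr; ring.
  rewrite ler_sum // => i _; rewrite li ler_wpM2l //.
  by move/int_halfspacesP: sx; apply; apply: mem_nth.
move=> /int_halfspacesP vK.
have [k|c cP] := lb (fun j => match j with inl j => 0
                       | inr i => (h i).2 - dot (intv R (h i).1) v end).
  rewrite big_sumType /= big1 ?add0r => [|j _]; last by rewrite mulr0.
  under eq_bigr do rewrite mulrBr.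
  rewrite sumrB subr_ge0.
  have := vK _ (map_f _ (mem_enum _ k)); rewrite /= intv_sum dot_suml.
  by congr (_ <= _); apply: eq_bigr => i _; rewrite ?dotZl li.
have {}aw j := aw (fun j => c 0 j) j.
have cE : \row_j c 0 j = c by apply/rowP => j; rewrite mxE.
rewrite cE in aw.
exists (v - \sum_j c 0 j *: intv R (g j)), (\sum_j c 0 j *: intv R (g j)).
split; last by rewrite subrK.
  apply/int_halfspacesP => _ /(nthP (0, 0))[i ilt <-].
  have := cP (inr (Ordinal ilt)); rewrite aw dotBr /h /= => ?; lra.
exists (fun j => c 0 j) => // j.
by have := cP (inl j); rewrite aw /=; lra.
Qed.

Definition box (B : R) : seq (M * R) :=
  [seq (delta_mx 0 i, B) | i <- enum 'I_n] ++ [seq (- delta_mx 0 i, B) | i <- enum 'I_n].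

Lemma intvN (u : M) : intv R (- u) = - intv R u.
Proof. by apply/rowP => i; rewrite !mxE mulrNz. Qed.

Lemma intv_delta i : intv R (delta_mx 0 i) = delta_mx 0 i :> V.
Proof. by apply/rowP => j; rewrite !mxE; case: (_ && _). Qed.

Lemma boxP B x : int_halfspaces (box B) x <-> forall i, `|x 0 i| <= B.
Proof.
split=> [/int_halfspacesP xB i|xB]; last first.
  apply/int_halfspacesP => h; rewrite mem_cat => /orP[] /mapP[i _ ->] /=;
    rewrite ?intvN intv_delta ?dotNl dotC dot_delta;
    by have := xB i; rewrite ler_norml => /andP[]; lra.
have h1 := xB (delta_mx 0 i, B); have h2 := xB (- delta_mx 0 i, B).
rewrite /= intvN intv_delta dotNl dotC dot_delta in h1 h2.
rewrite ler_norml lerNl h1 ?h2 //.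
  by rewrite mem_cat; apply/orP; right; apply/mapP; exists i; rewrite ?mem_enum.
by rewrite mem_cat; apply/orP; left; apply/mapP; exists i; rewrite ?mem_enum.
Qed.

Definition piece P (B : R) sigma : set V :=
  minkowski (P `&` int_halfspaces (box B)) sigma.

Lemma int_halfspaces_cat s s' :
  int_halfspaces (s ++ s') = int_halfspaces s `&` int_halfspaces s'.
Proof. by rewrite /int_halfspaces map_cat halfspaces_cat. Qed.

Lemma piece_integral_affine G P B sigma :
  G 0 -> (forall a b, G a -> G b -> G (a - b)) -> G B ->
  integral_affine G P -> integral_cone sigma -> piece P B sigma !=set0 ->
  integral_affine G (piece P B sigma).
Proof.
move=> G0 GB GbB [_ [s [Gs PE]]] cs Q0; split=> //.
have [|s' [Gs' E]] := @minkowski_cone_integral G (s ++ box B) sigma G0 GB _ cs.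
  move=> h; rewrite !mem_cat => /orP[/Gs //|/orP[]/mapP[i _ ->]//].
by exists s'; split=> //; rewrite -E int_halfspaces_cat -PE.
Qed.

(** Along a ray of the piece each functional defining [sigma] is bounded by its maximum on the box,
    so it is nonpositive on the direction. *)
Lemma recession_piece P B sigma : cone sigma -> piece P B sigma !=set0 ->
  recession (piece P B sigma) = sigma.
Proof.
move=> cs [q Qq]; apply/seteqP; split=> [w Qw|w sw]; last first.
  move=> _ [x [y [Px sy ->]]]; exists x, (y + w); split=> //; first exact: coneD.
  by rewrite addrA.
have [t tE] := cs; rewrite tE => u ut.
apply: (@dot_ray_le0 _ _ u q w ((\sum_i `|u 0 i|) * B)) => k.
have [x [y [[_ /boxP xB] sy E]]] := recession_iter k Qw Qq.
rewrite -dotZr -dotDr E dotDr -[leRHS]addr0 lerD //.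
  by apply: le_trans (ler_norm _) _; apply: dot_le.
by move: sy; rewrite tE; apply.
Qed.

(** For [v] in [P] one seeks a recession vector [w] with [v - w] in [P], close to [v - x0]. The
    system for [w] has the solution [0], and [v - x0] violates it by at most the total slack [d] of
    [x0]. Hoffman's bound then keeps [v - w] within [H * d] of [x0], uniformly in [v]. *)
Lemma bounded_plus_recession P : polyhedron P ->
  exists B0 : R, forall B v, B0 <= B -> P v -> piece P B (recession P) v.
Proof.
move=> [[x0 Px0] [s PE]]; rewrite PE in Px0 *.
have rE := recession_halfspaces (ex_intro _ x0 Px0).
pose h (i : 'I_(size s)) := nth (0, 0) s i.
have [H H0 HP] := hoffman (fun j : 'I_(size s) * bool =>
  if j.2 then (h j.1).1 else - (h j.1).1).
pose d := \sum_i ((h i).2 - dot (h i).1 x0).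
have d0 i : 0 <= (h i).2 - dot (h i).1 x0 by rewrite subr_ge0; apply/Px0/mem_nth.
have di i : (h i).2 - dot (h i).1 x0 <= d.
  by rewrite /d (bigD1 i) //= lerDl sumr_ge0.
have dge0 : 0 <= d by apply: sumr_ge0.
exists (H * d + \sum_i `|x0 0 i|) => B v Bd Pv.
have [||w [wP wv]] := HP (fun j => if j.2 then 0 else (h j.1).2 - dot (h j.1).1 v)
    (v - x0) d dge0.
- exists 0 => -[i [|]] /=; rewrite dot0r // subr_ge0; apply/Pv/mem_nth.
  exact: ltn_ord.
- move=> [i [|]] /=; rewrite ?dotNl dotBr.
    rewrite add0r; apply: le_trans (di i); rewrite lerD2r; apply/Pv/mem_nth.
    exact: ltn_ord.
  have := d0 i; have := di i; lra.
exists (v - w), w; split; last by rewrite subrK.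
  split.
    apply/halfspaces_nth => i; have := wP (i, false) => /=.
    rewrite dotNl dotBr /h; lra.
  apply/boxP => i; apply: le_trans Bd.
  have x0i : `|x0 0 i| <= \sum_i `|x0 0 i| by rewrite (bigD1 i) //= lerDl sumr_ge0.
  have := wv i; rewrite !mxE => wvi; apply: le_trans (lerD wvi x0i).
  rewrite (_ : v 0 i - w 0 i = - (w 0 i - (v 0 i - x0 0 i)) + x0 0 i); last ring.
  by rewrite -[X in _ <= X + _]normrN; apply: ler_normD.
rewrite rE; apply/halfspaces_homogeneousP => _ /(nthP (0, 0))[i ilt <-].
exact: (wP (Ordinal ilt, true)).
Qed.

Lemma fan_decomposition_exists G Delta (calP : set (set V)) a :
  G 0 -> (forall a b, G a -> G b -> G (a - b)) -> G a -> 0 < a ->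
  affine_collection G calP -> integral_fan Delta -> compactifying_fan Delta calP ->
  exists calQ, fan_decomposition G Delta calP calQ.
Proof.
move=> G0 GB Ga a0 [fP GP] [[[fD _ _ _] cD] iD] [_ cP].
have polyP P : calP P -> polyhedron P.
  by move=> /GP[P0 [s [_ PE]]]; split=> //; eexists; exact: PE.
(* The size of the box is taken in [G], since it becomes a right-hand side of the pieces. Outside
   [calP] the value is arbitrary. *)
have /choice[beta betaP] : forall P, exists B, calP P ->
    G B /\ forall v, P v -> piece P B (recession P) v.
  move=> P; have [/polyP/bounded_plus_recession[B0 B0P]|nP] := pselect (calP P).
    have [b Gb bB] := subgroup_unbounded G0 GB B0 Ga a0.
    by exists b => _; split=> // v; apply: B0P.
  by exists 0.
pose calQ := [set Q | exists P sigma, [/\ calP P, Delta sigma,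
  sigma `<=` recession P & Q = piece P (beta P) sigma]].
have pieceP P sigma : calP P -> sigma `<=` recession P ->
    piece P (beta P) sigma `<=` P.
  by move=> PP sP _ [x [w [[Px _] /sP Pw ->]]]; apply: Pw.
have piece0 P sigma : calP P -> Delta sigma -> piece P (beta P) sigma !=set0.
  move=> PP Ds; have [[v Pv] _] := polyP P PP.
  have [x [w [Px _ _]]] := (betaP P PP).2 v Pv.
  exists x, x, 0; split=> //; last by rewrite addr0.
  exact: cone0 (cD _ Ds).
exists calQ; split; last first.
  move=> _ [P [sigma [PP Ds sP ->]]].
  by rewrite recession_piece //; [apply: cD | apply: piece0].
split.
- split.
    apply: (@sub_finite_set _ _
      ((fun p => piece p.1 (beta p.1) p.2) @` (calP `*` Delta))).
      by move=> _ [P [sigma [PP Ds sP ->]]]; exists (P, sigma).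
    exact/finite_image/finite_setX.
  move=> _ [P [sigma [PP Ds sP ->]]]; apply: piece_integral_affine => //.
  + by have [] := betaP P PP.
  + exact: GP.
  + exact: iD.
  + exact: piece0.
- by move=> _ [P [sigma [PP Ds sP ->]]]; exists P => //; apply: pieceP.
- move=> P PP; have [D DD PD] := cP P PP.
  have DP sigma : D sigma -> sigma `<=` recession P.
    by move=> Ds w sw; rewrite PD; exists sigma.
  exists [set piece P (beta P) sigma | sigma in D].
    by move=> _ [sigma Ds <-]; exists P, sigma; split=> //; [apply: DD | apply: DP].
  apply/seteqP; split=> [v Pv|v [_ [sigma Ds <-]]]; last first.
    exact: (pieceP P sigma PP (DP sigma Ds)).
  have [x [w [Px + ->]]] := (betaP P PP).2 v Pv.
  rewrite PD => -[sigma Ds sw]; exists (piece P (beta P) sigma); first by exists sigma.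
  by exists x, w.
Qed.

End Decomposition.

(** * The value group of the algebraic closure *)

Section ValueGroup.
Context (R : realType) (L : fieldType) (abs : L -> R).
Hypothesis habs : nonarch_abs abs.

Lemma abs_gt0 x : x != 0 -> 0 < abs x.
Proof.
move=> /eqP x0; rewrite lt_neqAle (nonarch_abs_ge0 habs) andbT eq_sym.
by apply/eqP => /(nonarch_abs_eq0 habs).
Qed.

Lemma nonarch_abs1 : abs 1 = 1.
Proof.
have a1 := abs_gt0 (oner_neq0 L); apply: (mulfI (lt0r_neq0 a1)).
by rewrite -(nonarch_absM habs) !mulr1.
Qed.

Lemma ln_absM x y : x != 0 -> y != 0 -> ln (abs (x * y)) = ln (abs x) + ln (abs y).
Proof.
by move=> x0 y0; rewrite (nonarch_absM habs) lnM // posrE abs_gt0.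
Qed.

Lemma value_group0 : value_group abs 0.
Proof. by exists 1; rewrite /= ?oner_neq0 // nonarch_abs1 ln1 oppr0. Qed.

Lemma value_groupB a b :
  value_group abs a -> value_group abs b -> value_group abs (a - b).
Proof.
move=> [x /= x0 <-] [y /= y0 <-]; exists (x / y); first by rewrite /= mulf_neq0 ?invr_eq0.
have := @ln_absM (x / y) y; rewrite divfK // => -> //; first by ring.
by rewrite mulf_neq0 ?invr_eq0.
Qed.

Lemma ln_absX x k : x != 0 -> ln (abs (x ^+ k)) = k%:R * ln (abs x).
Proof.
move=> x0; elim: k => [|k IH]; first by rewrite expr0 nonarch_abs1 ln1 mul0r.
by rewrite exprS ln_absM ?expf_neq0 // IH -natr1; ring.
Qed.

End ValueGroup.

(** A [k]-th root of an element of nontrivial absolute value has its logarithm divided by [k]. The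
    sign is adjusted by negation in the group. *)
Lemma value_group_small (R : realType) (K : fieldType) (absK : K -> R)
    (Kbar : closedFieldType) (iota : {rmorphism K -> Kbar}) (absKbar : Kbar -> R) :
  nonarch_abs absK -> nontrivial_abs absK -> algebraic_closure absK iota absKbar ->
  forall e, 0 < e -> exists2 g, value_group absKbar g & 0 < g <= e.
Proof.
move=> hK [x [x0 x1]] [_ hKb ext] e e0.
pose k := (Num.bound (`|ln (absK x)| / e)).+1.
have [y yk] := @solve_monicpoly Kbar k (fun i => if i == 0%N then iota x else 0) (ltn0Sn _).
have {}yk : y ^+ k = iota x.
  rewrite yk big_ord_recl big1 /= ?expr0 ?mulr1 ?addr0 // => i _.
  by rewrite mul0r.
have y0 : y != 0.
  by apply: contraNneq x0 => y0; move: yk; rewrite y0 expr0n => /esym/eqP; rewrite fmorph_eq0.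
have lnx : ln (absK x) = k%:R * ln (absKbar y) by rewrite -(ln_absX hKb) // yk ext.
have lnx0 : ln (absK x) != 0.
  have ax := abs_gt0 hK x0; apply: contraNneq x1 => /(congr1 expR).
  by rewrite lnK ?posrE // expR0 => ->.
have k0 : 0 < k%:R :> R by rewrite ltr0n.
have ye : 0 < `|ln (absKbar y)| <= e.
  have lny : `|ln (absKbar y)| = `|ln (absK x)| / k%:R.
    by rewrite lnx normrM gtr0_norm // mulrC mulKf ?gt_eqF.
  rewrite lny divr_gt0 ?normr_gt0 //= ler_pdivrMr // mulrC -ler_pdivrMr // ltW //.
  apply: lt_le_trans (archi_boundP _) _; first by rewrite divr_ge0 // ltW.
  by rewrite ler_nat leqnSn.
have Gy : value_group absKbar (- ln (absKbar y)) by exists y.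
exists `|ln (absKbar y)| => //; case: (ger0P (ln (absKbar y))) => // _.
rewrite -[X in value_group _ X]opprK.
exact: (subgroupN (value_group0 hKb) (@value_groupB _ _ _ hKb)).
Qed.

Lemma finite_small (R : realType) (T : choiceType) (A : set T) (P : T -> R -> Prop) :
  finite_set A ->
  (forall x, A x -> exists2 e, 0 < e & forall d, 0 < d <= e -> P x d) ->
  exists2 e, 0 < e & forall d, 0 < d <= e -> forall x, A x -> P x d.
Proof.
move=> /finite_seqP[s ->] {A}; elim: s => [|x s IH] h.
  by exists 1.
have [|e e0 eP] := IH; first by move=> y ys; apply: h; rewrite /= inE ys orbT.
have [f f0 fP] := h x (mem_head _ _).
exists (Num.min e f) => [|d]; first by rewrite lt_min e0.
rewrite le_min => /and3P[d0 de df] y /=; rewrite inE => /predU1P[->|ys].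
  by apply: fP; rewrite d0.
by apply: eP => //; rewrite d0.
Qed.

(** * Small thickenings preserve a compactifying datum *)

Section Thickening.
Context (R : realType) (n : nat).
Local Notation V := 'rV[R]_n.
Implicit Types (P Q F : set V) (G : set R).

Lemma disjoint_thick s t : halfspaces s `&` halfspaces t = set0 :> set V ->
  exists2 e : R, 0 < e & forall d, 0 < d <= e ->
    halfspaces s `&` halfspaces (thick d t) = set0.
Proof.
rewrite -halfspaces_cat => /thick_set0[e e0 st]; exists e => // d /andP[d0 de].
rewrite -subset0 -(st d de) thick_cat halfspaces_cat => x [sx tx]; split=> //.
by apply: thick_sub0 sx; apply: ltW.
Qed.

Definition real_presentation (s : seq ('rV[int]_n * R)) : seq (V * R) :=
  [seq (intv R h.1, h.2) | h <- s].

Lemma int_halfspaces_thick d s :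
  int_halfspaces [seq (h.1, h.2 + d) | h <- s] = halfspaces (thick d (real_presentation s)).
Proof. by rewrite /int_halfspaces /thick /real_presentation -!map_comp. Qed.

Lemma compactifying_datum_thickening G (Sigma Sigma' : set (set V)) x
    (Delta calP calQ : set (set V)) :
  (forall a b, G a -> G b -> G (a - b)) ->
  (forall e, 0 < e -> exists2 g, G g & 0 < g <= e) ->
  finite_set Sigma -> (forall P, Sigma P -> polyhedron P) ->
  finite_set Sigma' -> (forall P, Sigma' P -> polyhedron P) ->
  let C := connected_component (supp Sigma `&` supp Sigma') x in
  compactifying_datum G (supp Sigma) (supp Sigma') Sigma' C Delta calP ->
  fan_decomposition G Delta calP calQ ->
  exists (f : set V -> set V) (delta : R),
    [/\ 0 < delta, G delta,
        forall Q, calQ Q -> exists s, affine_presentation G s Q /\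
          f Q = int_halfspaces [seq (h.1, h.2 + delta) | h <- s] &
        compactifying_datum G (supp Sigma) (supp Sigma') Sigma' C Delta (f @` calQ)].
Proof.
move=> GB Gsmall fS pS fS' pS' C.
move=> [[fP GP] CE iD [ptD cD] [_ compD]] [[[fQ GQ] QsubP PcupQ] QD].
have /choice[pres presP] : forall Q, exists s, calQ Q -> affine_presentation G s Q.
  move=> Q; have [/GQ[_ [s sP]]|nQ] := pselect (calQ Q); first by exists s.
  by exists [::].
pose rp Q := real_presentation (pres Q).
have QE Q : calQ Q -> Q = halfspaces (rp Q) by move=> /presP[].
have suppE : supp calQ = supp calP.
  apply/seteqP; split=> y.
    by move=> [Q QQ Qy]; have [P PP QP] := QsubP Q QQ; exists P => //; apply: QP.
  move=> [P PP]; have [D DQ ->] := PcupQ P PP => -[Q DQ' Qy].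
  by exists Q => //; apply: DQ.
(* Below [e1] no cell of the intersection meets a thickened member of [calQ] unless it met the
   member itself; [e2] does the same for the cells of [Sigma'], as compatibility requires. *)
have [|e1 e10 e1P] := @finite_small R _ ((Sigma `*` Sigma') `*` calQ)
  (fun q d => q.1.1 `&` q.1.2 `&` q.2 = set0 ->
     q.1.1 `&` q.1.2 `&` halfspaces (thick d (rp q.2)) = set0)
  (finite_setX (finite_setX fS fS') fQ).
  move=> [[F F'] Q] /= [[/pS[_ [s ->]] /pS'[_ [s' ->]]] /QE QQ].
  rewrite -halfspaces_cat {1}QQ.
  have [/disjoint_thick[e e0 eP]|ne] := pselect (halfspaces (s ++ s') `&` halfspaces (rp Q) = set0).
    by exists e => // d de _; apply: eP.
  by exists 1.
have [|e2 e20 e2P] := @finite_small R _ (Sigma' `*` calQ)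
  (fun q d => q.1 `&` q.2 = set0 -> q.1 `&` halfspaces (thick d (rp q.2)) = set0)
  (finite_setX fS' fQ).
  move=> [F' Q] /= [/pS'[_ [s' ->]] /QE QQ]; rewrite {1}QQ.
  have [/disjoint_thick[e e0 eP]|ne] := pselect (halfspaces s' `&` halfspaces (rp Q) = set0).
    by exists e => // d de _; apply: eP.
  by exists 1.
have [delta Gd /andP[d0 de]] := Gsmall (Num.min e1 e2) ltac:(by rewrite lt_min e10).
move: de; rewrite le_min => /andP[de1 de2].
have {}e1P F F' Q : Sigma F -> Sigma' F' -> calQ Q -> F `&` F' `&` Q = set0 ->
    F `&` F' `&` halfspaces (thick delta (rp Q)) = set0.
  by move=> SF SF' QQ; apply: (e1P delta _ ((F, F'), Q)) => //; apply/andP.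
have {}e2P F' Q : Sigma' F' -> calQ Q -> F' `&` Q = set0 ->
    F' `&` halfspaces (thick delta (rp Q)) = set0.
  by move=> SF' QQ; apply: (e2P delta _ (F', Q)) => //; apply/andP.
pose f Q := halfspaces (thick delta (rp Q)).
have Qf Q : calQ Q -> Q `<=` f Q.
  by move=> QQ; rewrite {1}(QE Q QQ); apply: thick_sub0; apply: ltW.
have f0 Q : calQ Q -> f Q !=set0.
  by move=> QQ; have [[y Qy] _] := GQ Q QQ; exists y; apply: Qf.
have recf Q : calQ Q -> recession (f Q) = recession Q.
  move=> QQ; rewrite [in RHS](QE Q QQ) /f !recession_halfspaces ?homogeneous_thick //.
    by rewrite -QE //; have [] := GQ Q QQ.
  exact: f0.
have polyf Q : calQ Q -> polyhedron (f Q).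
  by move=> /f0 fQ0; split=> //; eexists.
have polyQ Q : calQ Q -> polyhedron Q.
  by move=> QQ; split; [have [] := GQ Q QQ | exists (rp Q); apply: QE].
exists f, delta; split=> // [Q QQ|].
  by exists (pres Q); split; [apply: presP | rewrite int_halfspaces_thick].
split=> //.
- split; first exact: finite_image.
  move=> _ [Q QQ <-]; split; first exact: f0.
  exists [seq (h.1, h.2 + delta) | h <- pres Q]; split; last first.
    by rewrite int_halfspaces_thick.
  move=> _ /mapP[h hs ->] /=; have [Gs _] := presP Q QQ.
  have GD a b : G a -> G b -> G (a + b).
    move=> Ga Gb; rewrite -[b]opprK -[- b]sub0r; apply/GB => //; apply/GB => //.
    by rewrite -(subrr a); apply: GB.
  by apply: GD => //; apply: Gs.
- rewrite -suppE in CE; apply/seteqP; split=> y.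
    move=> [[[F SF Fy] [F' SF' F'y]] [_ [Q QQ <-] fQy]].
    (* The cell [F] meets [F'] in a convex set, and this set already contains a point [z] of [C]; so
       [y] lies in the same component. *)
    have [z [[Fz F'z] Qz]] : F `&` F' `&` Q !=set0.
      apply: contrapT => /set0P/negP/negPn/eqP /(e1P _ _ _ SF SF' QQ).
      by rewrite -subset0 => /(_ y); apply.
    have Cz : C z by rewrite -CE; split; [split; [exists F | exists F'] | exists Q].
    apply: connected_component_trans Cz _.
    have [_ [s sE]] := pS F SF; have [_ [s' sE']] := pS' F' SF'.
    apply: (@convex_connected_component _ _ (halfspaces (s ++ s'))).
    + exact: halfspaces_convex.
    + rewrite halfspaces_cat -sE -sE' => u [Fu F'u].
      by split; [exists F | exists F'].
    + by rewrite halfspaces_cat -sE -sE'.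
    + by rewrite halfspaces_cat -sE -sE'.
  rewrite -{1}CE => -[Ty [Q QQ Qy]]; split=> //.
  by exists (f Q); [exists Q | apply: Qf].
(* Thickening keeps the recession cone, which is a single cone of [Delta] by the choice of
   [calQ]. *)
- split=> // _ [Q QQ <-]; exists [set recession Q].
    by move=> _ ->; apply: QD.
  rewrite recf //; apply/seteqP; split=> [w Qw|w [_ -> //]].
  by exists (recession Q).
- split=> // S sigma [S0 [F' [P' [SF' [Q QQ QP'] SE]]]] Ds; rewrite {}SE -{}QP' in S0 *.
  have FQ0 : F' `&` Q !=set0.
    apply: contrapT => /set0P/negP/negPn/eqP /(e2P _ _ SF' QQ) E.
    by move: S0; rewrite E => -[].
  have [P PP QP] := QsubP Q QQ.
  have FP0 : F' `&` P !=set0 by have [y [F'y Qy]] := FQ0; exists y; split=> //; apply: QP.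
  have pP : polyhedron P by have [P0 [s [_ PE]]] := GP P PP; split=> //; eexists; exact: PE.
  have recQP : recession Q `<=` recession P.
    by apply: recessionS => //; have [] := GQ Q QQ.
  (* Compatibility is known for [P] only. If [sigma] lies in the larger cone of [P], then [sigma]
     meets the cone of [Q] in a face, which is all of [sigma] once it contains a relative interior
     point. *)
  have [|sF|sF] := compD (F' `&` P) sigma _ Ds; first by split=> //; exists F', P.
    move: sF; rewrite !recessionI ?recf //; [|exact: pS'|exact: polyf|exact: pS'].
    move=> sF; have [[[_ _ _ complD] coneD] _] := iD.
    have sQ0 : sigma `&` recession Q !=set0.
      by exists 0; split; apply: cone0; apply: coneD => //; apply: QD.
    have [face_sQ _] := complD sigma (recession Q) Ds (QD Q QQ) sQ0.
    have [E|/eqP/set0P[w [rw [F'w Qw]]]] :=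
        pselect (relint sigma `&` (recession F' `&` recession Q) = set0); [by right | left].
    have sw : sigma w by case: rw.
    have sub := relint_face_sub face_sQ rw (conj sw Qw).
    by move=> y sy; split; [have [] := sF y sy | have [] := sub y sy].
  right; rewrite -subset0 -sF !recessionI ?recf //; [|exact: pS'|exact: pS'|exact: polyf].
  by move=> w [rw [F'w /recQP Pw]].
Qed.

End Thickening.

(** * Translation by a generic cocharacter *)

Section GenericTranslation.
Context (R : realType) (n : nat).
Local Notation V := 'rV[R]_n.
Implicit Types (P Q F S : set V).

(* A vector on the moment curve avoids finitely many hyperplanes, since a
   nonzero polynomial vanishes at finitely many integers. *)
Lemma generic_integer_vector (cs : seq V) : (forall c, c \in cs -> c != 0) ->
  exists v : 'rV[int]_n, forall c, c \in cs -> dot c (intv R v) != 0.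
Proof.
move=> cs0; pose pol (c : V) : {poly R} := \sum_(i < n) c 0 i *: 'X^i.
have pol0 c : c != 0 -> pol c != 0.
  apply: contra => /eqP pc0; apply/eqP/rowP => i; rewrite mxE.
  have := congr1 (fun p : {poly R} => p`_i) pc0; rewrite coef0 coef_sum.
  rewrite (bigD1 i) //= big1 => [|j ji].
    by rewrite coefZ coefXn eqxx mulr1 addr0.
  by rewrite coefZ coefXn eq_sym val_eqE (negPf ji) mulr0.
pose p := \prod_(c <- cs) pol c.
have p0 : p != 0.
  by rewrite prodf_seq_neq0; apply/allP => c /cs0/pol0.
have [k pk] : exists k : nat, ~~ root p k%:R.
  apply: contrapT => /forallNP nk.
  have := @max_poly_roots _ p [seq k%:R | k <- iota 0 (size p)] p0.
  rewrite size_map size_iota ltnn => h; suff : false by []; apply: h.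
    by apply/allP => _ /mapP[k _ ->]; apply/negPn/negP/nk.
  rewrite map_inj_uniq ?iota_uniq // => i j /eqP.
  by rewrite eqr_nat => /eqP.
exists (\row_i (k%:Z ^+ i)) => c ccs.
have -> : dot c (intv R (\row_i k%:Z ^+ i)) = (pol c).[k%:R].
  rewrite horner_sum; apply: eq_bigr => i _.
  by rewrite !mxE hornerZ hornerXn rmorphXn.
apply: contraNneq pk => pc; rewrite /root /p horner_prod prodf_seq_eq0.
by apply/hasP; exists c => //=; rewrite pc.
Qed.

(** Stack maximal frames of [F] and [F']. If the rows do not span, a common normal is constant on
    the differences. If they do, the dimension bound makes them a basis, so the two direction spaces
    meet in [0] only. *)
Lemma complementary_pair F F' : F !=set0 -> F' !=set0 ->
  (polydim F + polydim F' <= n)%N ->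
  (exists c : V, c != 0 /\ exists kappa : R, forall x x', F x -> F' x' ->
      dot c (x - x') = kappa) \/
  ((polydim F + polydim F')%N = n /\
   forall x y x' y', F x -> F y -> F' x' -> F' y' -> x - y = x' - y' -> x = y).
Proof.
move=> F0 F'0 ddn.
have [p [B [Fp fB FB]]] := polydim_frame F0.
have [p' [B' [Fp' fB' FB']]] := polydim_frame F'0.
have span q : F q -> (q - p <= B)%MS by exact: frame_span.
have span' q : F' q -> (q - p' <= B')%MS by exact: frame_span.
pose N := col_mx B B'.
have [Nn|Nn] := ltnP (\rank N) n.
  left; have : kermx N^T != 0.
    by rewrite kermx_eq0 /row_free mxrank_tr; apply: contraL Nn => /eqP ->; rewrite ltnn.
  move=> /rowV0Pn[c /sub_kermxP cN c0]; exists c; split=> //.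
  have cNi i : dot c (row i N) = 0.
    have := congr1 (fun m => fun_of_matrix m 0 i) cN; rewrite !mxE => E.
    by rewrite -[RHS]E; apply: eq_bigr => j _; rewrite !mxE.
  have cB i : dot c (row i B) = 0 by rewrite -(cNi (lshift _ i)) rowKu.
  have cB' i : dot c (row i B') = 0 by rewrite -(cNi (rshift _ i)) rowKd.
  exists (dot c (p - p')) => x x' /span /(dot_submx_eq0 cB) + /span' /(dot_submx_eq0 cB').
  rewrite !dotBr; lra.
right; have E : (polydim F + polydim F')%N = n.
  by apply/eqP; rewrite eqn_leq ddn (leq_trans Nn) ?rank_leq_row.
split=> // x y x' y' Fx Fy Fx' Fy' xy.
have fN : row_free N.
  by rewrite /row_free eqn_leq rank_leq_row /=; apply: leq_trans Nn.
have diffE (a b c : V) : a - b = (a - c) - (b - c) by rewrite opprB addrA subrK.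
have xB : (x - y <= B)%MS.
  by rewrite (diffE _ _ p) addmx_sub ?eqmx_opp ?span.
have xB' : (x - y <= B')%MS.
  by rewrite xy (diffE _ _ p') addmx_sub ?eqmx_opp ?span'.
have [/submxP[a aE] /submxP[b bE]] := (xB, xB').
have : row_mx a (- b) *m N = 0 by rewrite mul_row_col -aE mulNmx -bE subrr.
move=> /eqP; rewrite mulmx_free_eq0 // => /eqP ab0.
apply/eqP; rewrite -subr_eq0 aE.
have -> : a = 0 by rewrite -[a](row_mxKl a (- b)) ab0 linear0.
by rewrite mul0mx.
Qed.

(** Undoing the translation violates the inequalities of [s] by at most [|r| * c], so [x] lies in a
    small thickening of [s ++ t]. That is empty for small [r] if [s ++ t] is infeasible; otherwise
    Hoffman's bound provides [y]. *)
Lemma translate_near (s t : seq (V * R)) (v : V) (eta : R) : 0 < eta ->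
  exists2 e : R, 0 < e & forall r x, `|r| <= e ->
    halfspaces s (x - r *: v) -> halfspaces t x ->
    exists2 y, halfspaces s y /\ halfspaces t y & forall i, `|y 0 i - x 0 i| <= eta.
Proof.
move=> eta0; pose c := \sum_(h <- s) `|dot h.1 v|.
have c0 : 0 <= c by apply: sumr_ge0.
have c1 : 0 < c + 1 by rewrite ltr_wpDl.
have thickst r x : halfspaces s (x - r *: v) -> halfspaces t x ->
    halfspaces (thick (`|r| * c) (s ++ t)) x.
  move=> sx tx; rewrite thick_cat halfspaces_cat; split; last first.
    by apply: thick_sub0 tx; rewrite mulr_ge0.
  apply/halfspaces_thickP => h hs; have := sx h hs; rewrite dotBr dotZr lerBlDr.
  move=> /le_trans; apply; rewrite lerD2l (le_trans (ler_norm _)) // normrM ler_wpM2l //.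
  by rewrite /c (big_rem h) //= lerDl sumr_ge0.
have [st0|nst] := pselect (halfspaces (s ++ t) !=set0); last first.
  have /thick_set0[e e0 eP] : halfspaces (s ++ t) = set0.
    by apply/eqP/negPn/negP => /set0P.
  exists (e / (c + 1)) => [|r x re sx tx]; first by rewrite divr_gt0.
  have : halfspaces (thick (`|r| * c) (s ++ t)) x by apply: thickst.
  rewrite eP //; apply: le_trans (_ : `|r| * (c + 1) <= _).
    by rewrite ler_wpM2l // lerDl.
  by rewrite -ler_pdivlMr.
have [H H0 HP] := hoffman_thick st0.
have H1 : 0 < H * c + 1 by rewrite ltr_wpDl // mulr_ge0.
exists (eta / (H * c + 1)) => [|r x re sx tx]; first by rewrite divr_gt0.
have [|y] := HP (`|r| * c) x _ (thickst _ _ sx tx); first by rewrite mulr_ge0.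
rewrite halfspaces_cat => sty yx; exists y => // i; apply: le_trans (yx i) _.
apply: le_trans (_ : `|r| * (H * c + 1) <= _).
  by rewrite mulrCA ler_wpM2l // lerDl.
by rewrite -ler_pdivlMr.
Qed.

Lemma thick_contains_ball (s : seq (V * R)) (delta : R) : 0 < delta ->
  exists2 eta : R, 0 < eta & forall y z : V, halfspaces s y ->
    (forall i, `|z 0 i - y 0 i| <= eta) -> halfspaces (thick delta s) z.
Proof.
move=> d0; pose c := \sum_(h <- s) \sum_i `|h.1 0 i|.
have c0 : 0 <= c by apply: sumr_ge0 => h _; apply: sumr_ge0.
have c1 : 0 < c + 1 by rewrite ltr_wpDl.
exists (delta / (c + 1)) => [|y z sy yz]; first by rewrite divr_gt0.
apply/halfspaces_thickP => h hs.
rewrite (_ : z = y + (z - y)); last by rewrite addrC subrK.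
rewrite dotDr; apply: lerD; first exact: sy.
apply: le_trans (ler_norm _) _.
apply: le_trans (_ : (\sum_i `|h.1 0 i|) * (delta / (c + 1)) <= _).
  by apply: dot_le => i; rewrite !mxE.
rewrite mulrA ler_pdivrMr // mulrC ler_wpM2l ?(ltW d0) //.
apply: le_trans (_ : c <= _); last by rewrite ltW // ltrDl.
by rewrite /c (big_rem h) //= lerDl sumr_ge0 // => k _; apply: sumr_ge0.
Qed.

Lemma generic_translation (Sigma Sigma' calQ : set (set V)) f (delta : R) :
  polyhedral_complex Sigma -> polyhedral_complex Sigma' ->
  (forall F F', Sigma F -> Sigma' F' -> (polydim F + polydim F' <= n)%N) ->
  finite_set calQ -> 0 < delta ->
  (forall Q, calQ Q -> exists2 s, Q = halfspaces s & f Q = halfspaces (thick delta s)) ->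
  supp Sigma `&` supp Sigma' `&` supp (f @` calQ) `<=` supp calQ ->
  exists (eps : R) (v : 'rV[int]_n), 0 < eps /\
    forall r : R, (- eps <= r < 0) || (0 < r <= eps) ->
      let S := translate (r *: intv R v) (supp Sigma)
                 `&` supp Sigma' `&` supp (f @` calQ) in
      [/\ finite_set S, S `<=` (supp (f @` calQ))° &
          forall x, S x ->
            (exists2 F, facet (translates (r *: intv R v) Sigma) F & relint F x) /\
            (exists2 F', facet Sigma' F' & relint F' x)].
Proof.
move=> [fS pS faceS capS] [fS' pS' faceS' capS'] dims fQ d0 hf sub.
have fSS := finite_setX fS fS'.
(* Pairs of cells whose differences lie in a hyperplane with normal [c]. The vector [v] is chosen
   transversal to one such normal for each degenerate pair. *)
pose deg (q : set V * set V) (c : V) := c != 0 /\ exists kappa : R,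
  forall x x', q.1 x -> q.2 x' -> dot c (x - x') = kappa.
have /choice[cc ccP] : forall q, exists c, (exists c', deg q c') -> deg q c.
  by move=> q; have [[c cP]|nc] := pselect (exists c, deg q c); [exists c | exists 0].
have [cs csE] : exists cs : seq V, [set` cs] =
    cc @` ((Sigma `*` Sigma') `&` [set q | exists c, deg q c]).
  by have /finite_seqP[cs ->] := finite_image cc (finite_setIl
    [set q | exists c, deg q c] fSS); exists cs.
have [c|v vP] := @generic_integer_vector cs.
  move=> ccs; have : [set` cs] c by [].
  by rewrite csE => -[q [_ /ccP[]]] c0 _ <-.
have [|e1 e10 e1P] := @finite_small R _ (Sigma `*` Sigma')
    (fun q d => (exists c, deg q c) -> forall r x, `|r| = d ->
       q.1 (x - r *: intv R v) -> q.2 x -> False) fSS.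
  move=> q SSq; have [dq|nd] := pselect (exists c, deg q c); last by exists 1.
  have [c0 [k kP]] := ccP q dq.
  have cv : dot (cc q) (intv R v) != 0.
    apply: vP; suff : [set` cs] (cc q) by [].
    by rewrite csE; exists q.
  (* A degenerate pair can meet for one value of [r] only. If that value is [0] it is excluded
     anyway; otherwise half its absolute value is a safe bound. *)
  have rE r x : q.1 (x - r *: intv R v) -> q.2 x -> r = - k / dot (cc q) (intv R v).
    move=> qx qx'; apply: (mulIf cv); rewrite divfK //.
    have := kP _ _ qx qx'.
    by rewrite addrAC subrr add0r dotNr dotZr => <-; rewrite opprK.
  have [k0|k0] := eqVneq k 0.
    exists 1 => // d /andP[d_gt0 _] _ r x rd qx /(rE r x qx) rk.
    by move: d_gt0; rewrite -rd rk k0 oppr0 mul0r normr0 ltxx.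
  have kcv : 0 < `|k / dot (cc q) (intv R v)|.
    by rewrite normr_gt0 mulf_neq0 ?invr_eq0.
  exists (`|k / dot (cc q) (intv R v)| / 2); first by rewrite divr_gt0.
  move=> d /andP[_ dk] _ r x rd qx /(rE r x qx) rk; move: dk; rewrite -rd rk mulNr normrN; lra.
have [|eta eta0 etaP] := @finite_small R _ calQ
    (fun Q d => forall y z : V, Q y -> (forall i, `|z 0 i - y 0 i| <= d) -> f Q z) fQ.
  move=> Q /hf[s QE fE]; have [eta eta0 etaP] := thick_contains_ball s d0.
  exists eta => // d /andP[_ de] y z Qy yz; rewrite fE; apply: (etaP y).
    by rewrite -QE.
  by move=> i; apply: le_trans (yz i) de.
have eta2 : 0 < eta / 2 by rewrite divr_gt0.
have [|e2 e20 e2P] := @finite_small R _ ((Sigma `*` Sigma') `*` calQ)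
    (fun q d => forall r (x : V), `|r| = d -> q.1.1 (x - r *: intv R v) -> q.1.2 x ->
       f q.2 x -> exists2 y, [/\ q.1.1 y, q.1.2 y & f q.2 y] &
                             forall i, `|y 0 i - x 0 i| <= eta / 2)
    (finite_setX fSS fQ).
  move=> [[F F'] Q] /= [[/pS[_ [s ->]] /pS'[_ [s' ->]]] /hf[t _ ->]].
  have [e e0 eP] := translate_near s (s' ++ thick delta t) (intv R v) eta2.
  exists e => // d /andP[_ de] r x rd sx s'x tx.
  have [||y [sy]] := eP r x _ sx; rewrite ?rd // halfspaces_cat //.
  by move=> [s'y ty] yx; exists y.
exists (Num.min e1 e2), v; split; first by rewrite lt_min e10.
move=> r rE S.
have [r0 re1 re2] : [/\ 0 < `|r|, `|r| <= e1 & `|r| <= e2].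
  have : 0 < `|r| <= Num.min e1 e2.
    case/orP: rE => /andP[rl rr].
      by rewrite ltr0_norm // oppr_gt0 rr lerNl.
    by rewrite gtr0_norm // rl.
  by rewrite le_min => /and3P.
have SP x : S x -> exists F F' Q, [/\ Sigma F, Sigma' F', calQ Q &
    [/\ F (x - r *: intv R v), F' x & f Q x]].
  move=> [[[y [F SF Fy] <-] [F' SF' F'y]] [_ [Q QQ <-] fQy]].
  by exists F, F', Q; rewrite addrK.
have transversal F F' : Sigma F -> Sigma' F' ->
    (exists2 x, F (x - r *: intv R v) & F' x) ->
    (polydim F + polydim F')%N = n /\
    forall x y, F (x - r *: intv R v) -> F' x -> F (y - r *: intv R v) -> F' y -> x = y.
  move=> SF SF' [x Fx F'x].
  have [[c cP]|[dE inj]] := complementary_pair (proj1 (pS F SF)) (proj1 (pS' F' SF')) (dims F F' SF SF').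
    exfalso; apply: (e1P `|r| _ (F, F') _ _ r x) => //; first by rewrite r0.
    by exists c.
  split=> // y z Fy F'y Fz F'z; apply: (addIr (- (r *: intv R v))).
  by apply: inj Fy Fz F'y F'z _; rewrite opprB addrA subrK.
split.
- apply: (@sub_finite_set _ _ (\bigcup_(q in Sigma `*` Sigma')
      [set x | q.1 (x - r *: intv R v) /\ q.2 x])).
    move=> x /SP[F [F' [Q [SF SF' _ [Fx F'x _]]]]].
    by exists (F, F').
  apply: bigcup_finite => // -[F F'] [/= SF SF'].
  have [[x [Fx F'x]]|nx] := pselect (exists x, F (x - r *: intv R v) /\ F' x).
    apply: (@sub_finite_set _ _ [set x]) => // y [Fy F'y].
    have [|_ inj] := transversal F F' SF SF'; first by exists x.
    exact: inj.
  apply: (@sub_finite_set _ _ set0) => // y yP; apply: nx; by exists y.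
- move=> x /SP[F [F' [Q [SF SF' QQ [Fx F'x fQx]]]]].
  have r02 : 0 < `|r| <= e2 by rewrite r0.
  have [y [Fy F'y fQy] yx] := e2P `|r| r02 ((F, F'), Q)
    (conj (conj SF SF') QQ) r x erefl Fx F'x fQx.
  (* The nearby point [y] of the untranslated intersection lies in an unthickened [Q']. The
     [eta]-ball around [y] is inside [f Q'], and it contains the [eta / 2]-ball around [x]. *)
  have [Q' QQ' Q'y] : supp calQ y.
    apply: sub; split; last by exists (f Q) => //; exists Q.
    by split; [exists F | exists F'].
  apply/nbhs_rowP; exists (eta / 2) => // z xz; exists (f Q'); first by exists Q'.
  apply: (etaP eta _ Q' QQ' y) => // [|i]; first by rewrite eta0 lexx.
  have := yx i; have := xz i; rewrite !ltr_norml !ler_norml => /andP[h1 h2] /andP[h3 h4].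
  apply/andP; split; lra.
- move=> x /SP[F [F' [Q [SF SF' QQ [Fx F'x _]]]]].
  have [dE _] := transversal F F' SF SF' (ex_intro2 _ _ x Fx F'x).
  (* Applied with a proper face in place of [F] or [F'], this contradicts the drop in dimension, so
     [x] is in both relative interiors. *)
  have not_face G1 G2 : Sigma G1 -> Sigma' G2 -> G1 (x - r *: intv R v) -> G2 x ->
      (polydim G1 + polydim G2)%N = n.
    by move=> S1 S2 G1x G2x; have [] := transversal G1 G2 S1 S2; first by exists x.
  (* In a complex, a cell strictly contained in another is a proper face of it, so a cell of largest
     dimension is maximal. *)
  have facetP (T : set (set V)) P : (forall P Q, T P -> T Q -> P `&` Q !=set0 ->
        face (P `&` Q) P /\ face (P `&` Q) Q) -> T P -> P !=set0 ->
      (forall P', T P' -> (polydim P' <= polydim P)%N) -> facet T P.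
    move=> cap TP P0 max; split=> // P' TP' PP'; apply: contrapT => ne.
    have PP'E : P `&` P' = P by apply/seteqP; split=> [y []//|y Py]; split=> //; apply: PP'.
    have [|_] := cap P P' TP TP'; first by rewrite PP'E.
    rewrite PP'E => fPP'; have [w P'w Pw] : exists2 w, P' w & ~ P w.
      apply: contrapT => /forall2NP nw; apply: ne; apply/seteqP; split=> // w P'w.
      by apply: contrapT => Pw; case: (nw w).
    by have := polydim_face_lt fPP' P'w Pw; rewrite ltnNge max.
  have [[F0 [s FE]] [F'0 [s' F'E]]] := (pS F SF, pS' F' SF').
  split.
    exists (translate (r *: intv R v) F).
      apply: facet_translates; apply: facetP => // P SP'.
      by rewrite -(leq_add2r (polydim F')) dE dims.
    rewrite -[x](subrK (r *: intv R v)); apply: relint_translate.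
    rewrite FE; rewrite FE in Fx; have [//|[G1 [fG G1x]]] := relint_or_face Fx.
    rewrite -FE in fG *; rewrite -(ltn_add2r (polydim F')) dE.
    by rewrite (not_face G1 F') ?ltnn //; apply: faceS fG.
  exists F'.
    apply: facetP => // P SP'.
    by rewrite -(leq_add2l (polydim F)) dE dims.
  rewrite F'E; rewrite F'E in F'x; have [//|[G1 [fG G1x]]] := relint_or_face F'x.
  rewrite -F'E in fG *; rewrite -(ltn_add2l (polydim F)) dE.
  by rewrite (not_face F G1) ?ltnn //; apply: faceS' fG.
Qed.

End GenericTranslation.

(** * Decomposition, thickening and translation combined *)

Theorem lemma4p7 (R : realType)
    (K : fieldType) (absK : K -> R)
    (hK : nonarch_abs absK) (hKnt : nontrivial_abs absK)
    (hKc : complete_abs absK)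
    (Kbar : closedFieldType) (iota : {rmorphism K -> Kbar}) (absKbar : Kbar -> R)
    (hKbar : algebraic_closure absK iota absKbar)
    (n : nat) (A : comAlgType K) (chi : 'rV[int]_n -> A)
    (hA : group_algebra chi)
    (I I' : set A) (hI : ideal I) (hI' : ideal I')
    (hcodim : (codim R I + codim R I')%E = krull_dim R [set 0 : A])
    (Sigma Sigma' : set (set 'rV[R]_n))
    (hSigma : complex_structure absK (value_group absKbar) chi I Sigma)
    (hSigma' : complex_structure absK (value_group absKbar) chi I' Sigma')
    (C : set 'rV[R]_n)
    (hC : exists2 x, (Trop absK chi I `&` Trop absK chi I') x &
            C = connected_component (Trop absK chi I `&` Trop absK chi I') x)
    (Delta calP : set (set 'rV[R]_n))
    (hdatum : compactifying_datum (value_group absKbar)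
                (Trop absK chi I) (Trop absK chi I') Sigma' C Delta calP) :
  exists (calP' : set (set 'rV[R]_n)) (eps : R) (v : 'rV[int]_n),
    [/\ fan_thickening (value_group absKbar) Delta calP calP',
        0 < eps,
        compactifying_datum (value_group absKbar)
          (Trop absK chi I) (Trop absK chi I') Sigma' C Delta calP' &
        forall r : R, (- eps <= r < 0) || (0 < r <= eps) ->
          let S := translate (r *: intv R v) (Trop absK chi I)
                     `&` Trop absK chi I' `&` supp calP' in
          [/\ finite_set S,
              S `<=` (supp calP')° &
              forall x, S x ->
                (exists2 F, facet (translates (r *: intv R v) Sigma) F
                            & relint F x) /\
                (exists2 F', facet Sigma' F' & relint F' x)]].
Proof.
have [csS csI dimS TS] := hSigma; have [csS' csI' dimS' TS'] := hSigma'.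
move: hdatum hC; rewrite TS TS' => datum [x _ CE]; rewrite {}CE in datum *.
have G0 := value_group0 (algebraic_closure_abs hKbar).
have GB := @value_groupB _ _ _ (algebraic_closure_abs hKbar).
have Gsmall := value_group_small hK hKnt hKbar.
(* Any positive element of the value group will do: its multiples give arbitrarily large boxes. *)
have [g Gg /andP[g0 _]] := Gsmall 1 ltr01.
have [affP _ iD cfD _] := datum.
have [calQ decQ] := fan_decomposition_exists G0 GB Gg g0 affP iD cfD.
have [fS pS _ _] := csS; have [fS' pS' _ _] := csS'.
have [f [delta [d0 Gd fP datum']]] :=
  compactifying_datum_thickening GB Gsmall fS pS fS' pS' datum decQ.
have [eps [v [eps0 generic]]] : exists (eps : R) (v : 'rV[int]_n), 0 < eps /\
    forall r : R, (- eps <= r < 0) || (0 < r <= eps) ->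
      let S := translate (r *: intv R v) (supp Sigma)
                 `&` supp Sigma' `&` supp (f @` calQ) in
      [/\ finite_set S, S `<=` (supp (f @` calQ))° &
          forall x, S x ->
            (exists2 F, facet (translates (r *: intv R v) Sigma) F & relint F x) /\
            (exists2 F', facet Sigma' F' & relint F' x)].
  apply: (@generic_translation _ _ Sigma Sigma' calQ f delta) => //.
  - move=> F F' SF SF'.
    exact: (complementary_dim hA hcodim (dimS _ SF) (dimS' _ SF')).
  - by have [[[]]] := decQ.
  - move=> Q /fP[s [[_ QE] ->]]; exists (real_presentation s) => //.
    by rewrite int_halfspaces_thick.
  (* Both data cut out the same [C], so the intersection inside the thickening lies in the support
     of [calP], which [calQ] covers. *)
  - have [[_ QP PQ] _] := decQ; have [_ CE' _ _ _] := datum'; have [_ CE _ _ _] := datum.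
    rewrite CE' -CE => y [_ [P PP]]; have [D DQ ->] := PQ P PP => -[Q DQ' Qy].
    by exists Q => //; apply: DQ.
exists (f @` calQ), eps, v; split=> //.
exists calQ => //; exists f => // Q /fP[s [sQ ->]].
by exists s, delta.
Qed.
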